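(* (1) Let $R$ be a core separative regular ring (in particular, $R$ may be any separative regular ring). Then every matrix $A\in \mathbb{M}_2(R)$ can be reduced to a diagonal matrix using three elementary row operations and three elementary column operations; that is, there are $2\times 2$ elementary matrices $E_1,E_2,E_3,F_1,F_2,F_3$ over $R$ such that $E_3E_2E_1\,A\,F_1F_2F_3$ is diagonal. (2) Nothing less on either side works in general: there exist a separative regular ring $S$ and a matrix in $\mathbb{M}_2(S)$ that cannot be reduced to a diagonal matrix using at most two elementary row operations together with any finite number of elementary column operations; and there exist a separative regular ring $T$ and a matrix in $\mathbb{M}_2(T)$ that cannot be reduced to a diagonal matrix using at most two elementary column operations together with any finite number of elementary row operations.
   Context: Rings are associative and unital. A ring $R$ is (von Neumann) regular if for every $a\in R$ there is $b\in R$ with $aba=a$. $\mathrm{FP}(R)$ denotes the category of finitely generated projective right $R$-modules. A ring $R$ is core separative if for all $A,B,C\in\mathrm{FP}(R)$, $R_R\cong A\oplus C\oplus C\cong B\oplus C\oplus C$ implies $A\oplus C\cong B\oplus C$. A regular ring $R$ is separative if for all $A,B,C\in\mathrm{FP}(R)$, $A\oplus C\oplus C\cong B\oplus C\oplus C$ implies $A\oplus C\cong B\oplus C$. A $2\times 2$ elementary matrix is one of the form $\begin{bmatrix}1 & x\\ 0 & 1\end{bmatrix}$ or $\begin{bmatrix}1 & 0\\ x & 1\end{bmatrix}$ with $x$ in the ring; an elementary row (respectively column) operation is left (respectively right) multiplication by an elementary matrix. *)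

(* Defs.v *)
From HB Require Import structures.
From mathcomp Require Import all_boot all_order all_algebra.

Set Implicit Arguments.
Unset Strict Implicit.
Unset Printing Implicit Defensive.

Import GRing.Theory.
Local Open Scope ring_scope.

(* Rings are [pzRingType]s: associative and unital, not necessarily
   commutative, the zero ring being allowed. *)

Definition von_neumann_regular (R : pzRingType) : Prop :=
  forall a : R, exists b : R, a * b * a = a.

(* MathComp modules are left modules, so a right R-module is a left module
   over the converse ring R^c, where [a *: v] stands for v a. *)
Notation rmodType R := (lmodType R^c).

(* The scalar action on [R^c^o] is a *: x = x * a, so this is R_R. *)
Definition regular_rmod (R : pzRingType) : rmodType R := R^c^o.

Definition rmod_iso (R : pzRingType) (M N : rmodType R) : Prop :=
  exists f : {linear M -> N}, bijective f.

Definition finitely_generated (R : pzRingType) (M : rmodType R) : Prop :=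
  exists (n : nat) (v : 'I_n -> M),
    forall x : M, exists c : 'I_n -> R^c, x = \sum_(i < n) c i *: v i.

Definition projective (R : pzRingType) (M : rmodType R) : Prop :=
  forall (N P : rmodType R) (g : {linear N -> P}) (f : {linear M -> P}),
    (forall y : P, exists x : N, g x = y) ->
    exists h : {linear M -> N}, forall x : M, g (h x) = f x.

Definition FP (R : pzRingType) (M : rmodType R) : Prop :=
  finitely_generated M /\ projective M.

Definition dsum (R : pzRingType) (M N : rmodType R) : rmodType R :=
  (M * N)%type.

Definition core_separative (R : pzRingType) : Prop :=
  forall A B C : rmodType R, FP A -> FP B -> FP C ->
    rmod_iso (regular_rmod R) (dsum (dsum A C) C) ->
    rmod_iso (dsum (dsum A C) C) (dsum (dsum B C) C) ->
    rmod_iso (dsum A C) (dsum B C).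

Definition separative (R : pzRingType) : Prop :=
  forall A B C : rmodType R, FP A -> FP B -> FP C ->
    rmod_iso (dsum (dsum A C) C) (dsum (dsum B C) C) ->
    rmod_iso (dsum A C) (dsum B C).

(* The matrix with rows (a, b) and (c, d). *)
Definition mx2 (R : pzRingType) (a b c d : R) : 'M[R]_2 :=
  \matrix_(i, j) if i == 0 then (if j == 0 then a else b)
                 else (if j == 0 then c else d).

Definition elementary (R : pzRingType) (E : 'M[R]_2) : Prop :=
  exists x : R, E = mx2 1 x 0 1 \/ E = mx2 1 0 x 1.

Definition elementary_seq (R : pzRingType) (s : seq 'M[R]_2) : Prop :=
  forall E : 'M[R]_2, E \in s -> elementary E.

Definition mx_prod (R : pzRingType) (s : seq 'M[R]_2) : 'M[R]_2 :=
  \big[mulmx/1%:M]_(E <- s) E.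

(* Main.v *)
Require Import Defs.
From HB Require Import structures.
From mathcomp Require Import all_boot all_order all_algebra.
From mathcomp Require Import boolp classical_sets.

Set Implicit Arguments.
Unset Strict Implicit.
Unset Printing Implicit Defensive.

Import GRing.Theory.
Local Open Scope ring_scope.


(** Part (1).  Read A as a homomorphism S1 + S2 -> R1 + R2 between sums of two
    copies of R_R.  Regularity allows one row and one column operation to make A
    orthogonal ([orthogonalize]): its four entries become partial isomorphisms,
    and the copies of R_R split as
      S1 = r + q + k1,  S2 = x + p + k2,  R1 = r + p + n1,  R2 = x + q + n2
    in such a way that A is the identity on r, p, q, x and zero on k1, k2.

    Two column operations change the decomposition S1 + S2 into one whose second
    summand is v R with v = (t, 1 + s t), and two row operations change R1 + R2
    into one whose first summand is v' R with v' = (1 + e t', t').  If A maps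
    everything into A v R + v' R and A v R meets v' R in 0, then in the new
    decompositions both off-diagonal entries are multiples of the lower right
    entry, and one last operation on each side clears them
    ([complete_reduction]).  On each side the first of these operations is of the
    same kind as the one that made A orthogonal and merges with it, which leaves
    three on each side.

    The submodules v R and v' R are found by exchange: a piece of S2 is traded
    against an isomorphic piece of S1, and a piece of R1 against an isomorphic
    piece of R2 ([fine_reducible]).  The pieces to be traded, and the two
    isomorphisms between them, come from a computation with isomorphism classes
    of summands of R_R ([monoid_exchange]).  The classes of the four
    decompositions of R_R above are refined against one another, and common
    summands are cancelled by core separativity in the form: if a + c and b + c
    are both the class of R_R and c is a summand of both a and b, then a = b.

    Part (2).  Call elements with t_i s_j = delta_ij and s0 t0 + s1 t1 = 1 a
    Leavitt quadruple.  If every finite subset of a ring commutes with such a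
    quadruple, then multiplication by it splits every finitely generated
    projective M as M + M, which makes the ring separative for trivial reasons
    ([asymptotically_leavitt_separative]).  A nonzero regular ring Q of this kind
    is obtained from the additive maps on the Boolean functions of infinitely many
    natural-number variables that act through finitely many of the variables; the
    variables left untouched carry the quadruples ([lendo_regular],
    [lendo_asymptotically_leavitt]).  Over Q the row (s0, s1) is an isomorphism
    Q^2 -> Q, so no invertible change of columns produces a zero entry in it.
    A product of two elementary matrices has a diagonal entry 1, hence it
    preserves such a row in the first or in the second place; the matrix over
    Q x Q with (s0, s1) in its first row in one factor and in its second row in
    the other factor therefore resists two row operations
    ([row_obstructionP]), and its transpose analogue with (t0, t1) resists two
    column operations ([column_obstructionP]). *)

(** * Equations in commutative monoids by reflection *)

Section AC.
Variables (V : Type) (z : V) (add : V -> V -> V).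
Hypotheses (addC : forall a b, add a b = add b a)
  (addA : forall a b c, add a (add b c) = add (add a b) c)
  (add0 : forall a, add z a = a).
Inductive ac_term := AcZero | AcVar of nat | AcAdd of ac_term & ac_term.
Fixpoint ac_eval (env : seq V) e :=
  match e with AcZero => z | AcVar i => nth z env i | AcAdd a b => add (ac_eval env a) (ac_eval env b) end.
Fixpoint ac_leaves e := match e with AcZero => [::] | AcVar i => [:: i] | AcAdd a b => ac_leaves a ++ ac_leaves b end.
Definition ac_sum env (l : seq nat) := foldr (fun i s => add (nth z env i) s) z l.
Lemma ac_sum_cat env l1 l2 : ac_sum env (l1 ++ l2) = add (ac_sum env l1) (ac_sum env l2).
Proof. by elim: l1 => [|i l IH] /=; rewrite ?add0 // IH addA. Qed.
Lemma ac_evalE env e : ac_eval env e = ac_sum env (ac_leaves e).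
Proof.
by elim: e => [|i|a Ha b Hb] /=; rewrite ?ac_sum_cat -?Ha -?Hb // addC add0.
Qed.
Lemma ac_eqP env e1 e2 : perm_eq (ac_leaves e1) (ac_leaves e2) -> ac_eval env e1 = ac_eval env e2.
Proof.
rewrite !ac_evalE; apply: (catCA_perm_subst (F := ac_sum env)) => a b c.
by rewrite !ac_sum_cat !addA [add (ac_sum env b) _]addC.
Qed.
End AC.

Ltac ac_find a l :=
  match l with
  | cons ?b _ => let _ := match goal with _ => unify a b end in constr:(O)
  | cons _ ?t => let n := ac_find a t in constr:(S n)
  end.
Ltac ac_insert a l :=
  match l with
  | _ => let _ := ac_find a l in l
  | _ => constr:(cons a l)
  end.
Ltac ac_atoms z add l e :=
  match e with
  | ?f ?a ?b =>
    let _ := match goal with _ => unify f add end in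
    let l := ac_atoms z add l a in ac_atoms z add l b
  | _ => let _ := match goal with _ => unify e z end in l
  | _ => ac_insert e l
  end.
Ltac ac_reify z add l e :=
  match e with
  | ?f ?a ?b =>
    let _ := match goal with _ => unify f add end in
    let a := ac_reify z add l a in let b := ac_reify z add l b in constr:(AcAdd a b)
  | _ => let _ := match goal with _ => unify e z end in constr:(AcZero)
  | _ => let n := ac_find e l in constr:(AcVar n)
  end.
Ltac ac_with z add addC addA add0 :=
  match goal with |- ?e1 = ?e2 =>
    let T := type of e1 in
    let l := ac_atoms z add (@nil T) e1 in let l := ac_atoms z add l e2 in
    let r1 := ac_reify z add l e1 in let r2 := ac_reify z add l e2 in
    exact (@ac_eqP _ z add addC addA add0 l r1 r2 (erefl true))
  end.

(** * The exchange lemma for classes of summands *)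

(** The monoid of isomorphism classes of modules enters only through refinement
    and core separativity, both restricted to sums that are bounded by the class
    u of R_R. *)
Section ML.
Variables (V : Type) (z : V) (add : V -> V -> V).
Local Notation "a + b" := (add a b).
Hypotheses (addC : forall a b, a + b = b + a)
  (addA : forall a b c, a + (b + c) = a + b + c)
  (add0 : forall a, z + a = a).
Variable u : V.
Hypothesis refinement : forall a b c d e, a + b = c + d -> a + b + e = u ->
  exists ac ad bc bd, [/\ a = ac + ad, b = bc + bd, c = ac + bc & d = ad + bd].
Hypothesis core : forall a b c, a + c + c = u -> b + c + c = u -> a + c = b + c.
Ltac ac := ac_with z add addC addA add0.

(** Core separativity as a cancellation law: the summand c may be cancelled from
    a + c = b + c = u once it also occurs inside a and inside b. *)
Lemma cancel_le a b c a' b' : a = a' + c -> b = b' + c ->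
  a + c = u -> b + c = u -> a = b.
Proof. by move=> -> ->; apply: core. Qed.

Lemma refinement3 a s b1 b2 b3 e : a + s = b1 + b2 + b3 -> a + s + e = u ->
  exists a1 a2 a3 s1 s2 s3, [/\ a = a1 + a2 + a3, s = s1 + s2 + s3
    & [/\ b1 = a1 + s1, b2 = a2 + s2 & b3 = a3 + s3]].
Proof.
move=> E U; have E' : a + s = b1 + (b2 + b3) by rewrite E; ac.
have [a1 [a' [s1 [s' [Ea Es Eb1 Eb]]]]] := refinement E' U.
have U' : a' + s' + (a1 + s1 + e) = u by rewrite -U Ea Es; ac.
have [a2 [s2 [a3 [s3 [Eb2 Eb3 Ea' Es']]]]] :=
  refinement Eb (etrans (congr1 (fun w => w + _) Eb) U').
exists a1, a2, a3, s1, s2, s3; split; [subst; ac|subst; ac|split; subst; ac].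
Qed.

(** The four hypotheses are the four decompositions of R_R.  The last two
    conclusions are the exchanges: the part x1 + p1 + k21 of S2 is traded for the
    part r + q0 + k10 of S1, and the part r + (p00 + t) + n10 of R1 for the part
    x1 + q1 + n21 of R2.  They hold only up to the auxiliary summands t and n11,
    which must therefore also embed in q1 + k11 and in x0 + q0.

    The main difficulty is that p is a summand of both S2 and R1.  Refining p
    against S1 and R2 leaves p = c + T + pn with c inside r and inside x + T, with
    T inside S1, and with pn inside R2; core separativity cancels c, and refining
    the result once more, column pn included, gives all pieces. *)
Lemma monoid_exchange (x p q r k1 k2 n1 n2 : V) :
  x + p + k2 = u -> r + q + k1 = u -> r + p + n1 = u -> x + q + n2 = u ->
  exists x0 x1 p00 t p1 q0 q1 k20 k21 k10 k11 n10 n11 n12 n20 n21 y m,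
    [/\ [/\ x = x0 + x1, p = p00 + t + p1 & q = q0 + q1],
      [/\ k2 = k20 + k21, k1 = k10 + k11, n1 = n10 + n11 + n12 & n2 = n20 + n21],
      q1 + k11 = t + y /\ x0 + q0 = n11 + m,
      x1 + p1 + k21 + t = r + q0 + k10 + t
    & r + (p00 + t) + n10 + n11 = x1 + q1 + n21 + n11].
Proof.
move=> HA HB HC HD.
(* Refine p against S1, the part of p in r against R2, and the two resulting
   decompositions of q against each other. *)
have E1 : p + (x + k2) = r + (q + k1) by transitivity u; [rewrite -HA|rewrite -HB]; ac.
have U1 : p + (x + k2) + z = u by transitivity (x + p + k2); first ac.
have [pr [pqk [r' [qk' [Ep _ Er Eqk]]]]] := refinement E1 U1.
have U2 : q + k1 + r = u by transitivity (r + q + k1); first ac.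
have [pq [q' [pk [k' [Eq Ek1 Epqk _]]]]] := refinement Eqk U2.
have E2 : pr + (r' + p + n1) = x + (q + n2).
  by transitivity u; [rewrite -HC Er|rewrite -HD]; ac.
have U3 : pr + (r' + p + n1) + z = u by transitivity (x + q + n2); rewrite ?E2; first ac.
have [px [pdn [x' [qn' [Epr _ Ex Eqn]]]]] := refinement E2 U3.
have U4 : q + n2 + x = u by transitivity (x + q + n2); first ac.
have [pd [q'' [pn [n2' [Eq' En2 Epdn _]]]]] := refinement Eqn U4.
have E3 : pd + q'' = pq + q' by rewrite -Eq -Eq'.
have U5 : pd + q'' + (x + n2) = u.
  by transitivity (x + q + n2); first by rewrite Eq'; ac.
have [d1 [d2 [e1 [e2 [Epd Eq'' Epq Eq2]]]]] := refinement E3 U5.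
clear Eqk U2 E1 U1 E2 U3 Eqn U4 E3 U5 Eq'.
subst pd q'' pq q' pqk q k1 pdn n2 pr x r p; clear qn' qk'.
(* Now c is px + d1, and T is Tq + pk. *)
set x := px + x'.
set Tq := d1 + e1 + d2.
set p := _ + (_ + pk) in HA HC.
have CS1 : x + k2 + Tq + pk + pn = px + (d1 + d2 + pn) + r' + n1 + Tq + pk + pn.
  apply: (@cancel_le _ _ (px + d1) (x' + e1 + d2 + pk + k2 + pn)
           (d2 + pn + r' + n1 + Tq + pk + pn)); rewrite /x /Tq; try ac.
- by transitivity (x + p + k2); first by rewrite /x /p; ac.
- by transitivity (px + (d1 + d2 + pn) + r' + p + n1); first by rewrite /p; ac.
(* Refine the rows x, k2, Tq, pk, pn against the columns rho, n1, pn; the third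
   index letter r, n, s of a piece names its column. *)
set rho := px + (d1 + d2 + pn) + r' + Tq + pk.
have CS2 : x + (k2 + Tq + pk + pn) = rho + n1 + pn.
  by transitivity (x + k2 + Tq + pk + pn); [ac|rewrite CS1 /rho; ac].
have U6 : x + (k2 + Tq + pk + pn) + (px + d1) = u.
  by transitivity (x + p + k2); first by rewrite /x /p /Tq; ac.
have [xr [xn [xs [w1r [w1n [w1s [X W [Erho En1 Epn]]]]]]]] := refinement3 CS2 U6.
have {}W : k2 + (Tq + pk + pn) = w1r + w1n + w1s by rewrite -W; ac.
have U7 : k2 + (Tq + pk + pn) + (x + (px + d1)) = u by rewrite -U6; ac.
have [k2r [k2n [k2s [w2r [w2n [w2s [K2 W2 [Ew1r Ew1n Ew1s]]]]]]]] := refinement3 W U7.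
have {}W2 : Tq + (pk + pn) = w2r + w2n + w2s by rewrite -W2; ac.
have U8 : Tq + (pk + pn) + (k2 + x + (px + d1)) = u by rewrite -U7; ac.
have [tr [tn [ts [w3r [w3n [w3s [TQ W3 [Ew2r Ew2n Ew2s]]]]]]]] := refinement3 W2 U8.
have U9 : pk + pn + (Tq + k2 + x + (px + d1)) = u by rewrite -U8; ac.
have [lr [ln [ls [sr [sn [ss [LK SG [Ew3r Ew3n Ew3s]]]]]]]] := refinement3 W3 U9.
subst w1r w1n w1s w2r w2n w2s w3r w3n w3s.
clear CS2 W W2 W3 U6 U7 U8 U9.
(* The summand pn occurs as a row and as a column, so its two decompositions
   are refined against each other: k2s, ls, om, ss against sr, sn, ss. *)
set om := xs + ts.
have S1 : k2s + (ls + om + ss) = sr + sn + ss by rewrite -SG Epn /om; ac.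
(* The added term is the complement of pn in u, written through HC. *)
have V1 : k2s + (ls + om + ss) + (px + r' + n1 + (d1 + e1 + pk) + px + d1 + d2 + d1 + d2 + pn) = u.
  rewrite S1 -SG -HC /p; ac.
set e0 := px + r' + _ + _ + _ + _ + _ + _ + _ + _ in V1.
have [ar [an [as_ [w1r [w1n [w1s [K2S W [Esr Esn Ess]]]]]]]] := refinement3 S1 V1.
have {}W : ls + (om + ss) = w1r + w1n + w1s by rewrite -W; ac.
have V2 : ls + (om + ss) + (k2s + e0) = u by rewrite -V1; ac.
have [br [bn [bs [w2r [w2n [w2s [LS W2 [Ew1r Ew1n Ew1s]]]]]]]] := refinement3 W V2.
have V3 : om + ss + (ls + (k2s + e0)) = u by rewrite -V2; ac.
have [or [on [os [cr [cn [cs [OM SS [Ew2r Ew2n Ew2s]]]]]]]] := refinement3 W2 V3.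
clear W W2 S1 V1 V2 V3; clearbody e0; clear e0.
subst w1r w1n w1s w2r w2n w2s.
exists (xn + xs), xr, (px + d1 + (tn + ts + ln + bn + bs) + (ar + br) + sn + ss),
  (tr + lr + br), (or + cr), (tn + ts), (tr + e2), (k2n + an + as_), (k2r + ar),
  (ln + bn + bs), (lr + br + k'), (k2n + ln + an + bn), (xn + tn), (on + cn),
  (as_ + bs), (om + k2s + ls + os + cs + n2'), (e2 + k'), om.
have ER : rho = px + (d1 + d2 + pn) + r' + (tn + ts + ln + bn + bs) + (tr + lr + br).
  by transitivity (px + (d1 + d2 + pn) + r' + Tq + pk); rewrite // TQ LK LS; ac.
have EN2 : pn + n2' = as_ + bs + (om + k2s + ls + os + cs + n2').
  by rewrite Epn Ess /om; ac.
have EP : px + (d1 + d2 + pn) + (d1 + e1 + pk)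
    = px + d1 + (tn + ts + ln + bn + bs) + (ar + br) + sn + ss + (tr + lr + br) + (or + cr).
  transitivity (px + d1 + Tq + pk + pn); first by rewrite /Tq; ac.
  by rewrite TQ LK SG LS Esr; ac.
have EQ : d1 + e1 + (d2 + e2) = tn + ts + (tr + e2).
  by transitivity (Tq + e2); [rewrite /Tq|rewrite TQ]; ac.
have EN1 : n1 = k2n + ln + an + bn + (xn + tn) + (on + cn) by rewrite En1 Esn; ac.
split; first split.
- by rewrite X; ac.
- by rewrite EP; ac.
- exact: EQ.
- by split=> //; [rewrite K2 K2S; ac|rewrite LK LS; ac].
- by split; rewrite /om; ac.
- transitivity rho; first by rewrite Erho Esr; ac.
  by rewrite ER; ac.
(* For the second exchange, add J = om + as_ + bs to both sides: they become
   r + p + n1 and x + q + n2, which both equal u. *)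
have ESS : as_ + (bs + (os + cs)) = cr + cn + cs by rewrite -Ess SS.
have EJ : om + as_ + bs = or + on + os + as_ + bs by rewrite OM.
apply: (@cancel_le _ _ (om + as_ + bs)
  (xr + k2r + tr + lr + ar + br + cr + px + d1 + ar + br + an + bn + cn + cs
   + (k2n + ln + an + bn) + (xn + tn))
  (xr + (tr + e2) + (ar + an + br + bn + os + cs + n2') + (xn + tn))).
- rewrite EJ.
  transitivity (rho + (px + d1 + (ar + br) + sn + ss + (k2n + ln + an + bn) + (xn + tn))).
    by rewrite ER; ac.
  by rewrite Erho Esr Esn Ess; ac.
- by rewrite K2S LS; ac.
- transitivity (px + (d1 + d2 + pn) + r' + p + n1); last by [].
  by rewrite /p EP EN1 OM {1}SS Ess; ac.
- transitivity (x + (d1 + e1 + (d2 + e2)) + (pn + n2')); last by [].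
  by rewrite X EQ EN2 /om; ac.
Qed.
End ML.

(** * Linear maps and splitting of idempotents *)

Section Maps.
Variable K : pzRingType.
Implicit Types M N P : lmodType K.

Lemma pair_fun_linear M N P (f : {linear M -> N}) (g : {linear M -> P}) :
  linear (fun x => (f x, g x) : (N * P)%type).
Proof. by move=> c x y; rewrite !linearP. Qed.
Definition lpair M N P (f : {linear M -> N}) (g : {linear M -> P}) :
  {linear M -> (N * P)%type} :=
  HB.pack (fun x => (f x, g x) : (N * P)%type)
    (GRing.isLinear.Build _ _ _ _ _ (pair_fun_linear f g)).
Definition lcomp M N P (f : {linear N -> P}) (g : {linear M -> N}) : {linear M -> P} :=
  f \o g.
Definition lfst M N : {linear (M * N)%type -> M} := fst.
Definition lsnd M N : {linear (M * N)%type -> N} := snd.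
Definition lid M : {linear M -> M} := idfun.
Definition lzero M N : {linear M -> N} := \0.
Definition ladd M N (f g : {linear M -> N}) : {linear M -> N} := f \+ g.
Definition lsub M N (f g : {linear M -> N}) : {linear M -> N} := f \- g.

Lemma bij_inv M N (f : {linear M -> N}) : bijective f ->
  exists g : {linear N -> M}, cancel f g /\ cancel g f.
Proof.
move=> [g fK gK]; have gL : linear g.
  by move=> c x y; apply: (can_inj fK); rewrite linearP !gK.
pose g' : {linear N -> M} := HB.pack g (GRing.isLinear.Build _ _ _ _ _ gL).
by exists g'.
Qed.

Section Split.
Variables (M : lmodType K) (e : {linear M -> M}).
Definition fixpts : {pred M} := [pred x | e x == x].
Lemma fixpts_closed : submod_closed fixpts.
Proof.
split=> [|c x y]; first by rewrite inE linear0.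
by rewrite !inE linearP => /eqP-> /eqP->.
Qed.
HB.instance Definition _ := GRing.isSubmodClosed.Build K M fixpts fixpts_closed.
Record fixpt := Fixpt {fixpt_val :> M; _ : fixpt_val \in fixpts}.
HB.instance Definition _ := [isSub for fixpt_val].
HB.instance Definition _ := [Choice of fixpt by <:].
HB.instance Definition _ := [SubChoice_isSubLmodule of fixpt by <:].
Lemma split_idempotent : (forall x, e (e x) = e x) ->
  exists (N : lmodType K) (i : {linear N -> M}) (p : {linear M -> N}),
    cancel i p /\ forall x, i (p x) = e x.
Proof.
move=> ee; have eP x : e x \in fixpts by rewrite inE ee.
pose q x : fixpt := Fixpt (eP x).
have qL : linear q by move=> c x y; apply: val_inj; rewrite /= linearP.
pose q' : {linear M -> fixpt} := HB.pack q (GRing.isLinear.Build _ _ _ _ _ qL).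
exists fixpt, (val : {linear fixpt -> M}), q'; split=> // -[x xP].
by apply: val_inj => /=; move: xP; rewrite inE => /eqP.
Qed.
End Split.
End Maps.

(** * Summands of the regular module *)

Section Iso.
Variable R : pzRingType.
Local Notation mod := (rmodType R).
Local Notation RR := (regular_rmod R).
Implicit Types M N P Q : mod.

Lemma rmod_iso_intro M N (f : {linear M -> N}) (g : {linear N -> M}) :
  cancel f g -> cancel g f -> rmod_iso M N.
Proof. by move=> fK gK; exists f; exists g. Qed.
Lemma rmod_iso_elim M N : rmod_iso M N -> exists (f : {linear M -> N}) (g : {linear N -> M}),
  cancel f g /\ cancel g f.
Proof. by case=> f /bij_inv[g gP]; exists f, g. Qed.
Lemma rmod_iso_refl M : rmod_iso M M.
Proof. by exists (lid M); exists id. Qed.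
Lemma rmod_iso_sym M N : rmod_iso M N -> rmod_iso N M.
Proof. by case/rmod_iso_elim=> f [g [fK gK]]; exists g; exists f. Qed.
Lemma rmod_iso_trans M N P : rmod_iso M N -> rmod_iso N P -> rmod_iso M P.
Proof. by case=> f fb [g gb]; exists (lcomp g f); exact: bij_comp. Qed.

Definition lmap M N P Q (f : {linear M -> N}) (g : {linear P -> Q}) :
  {linear dsum M P -> dsum N Q} :=
  lpair (lcomp f (lfst M P)) (lcomp g (lsnd M P)).

Lemma dsum_iso M N P Q : rmod_iso M N -> rmod_iso P Q -> rmod_iso (dsum M P) (dsum N Q).
Proof.
case/rmod_iso_elim=> f [f' [fK f'K]] /rmod_iso_elim[g [g' [gK g'K]]].
apply: (@rmod_iso_intro _ _ (lmap f g) (lmap f' g')) => -[x y] /=.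
  by rewrite fK gK.
by rewrite f'K g'K.
Qed.
Lemma dsumC M N : rmod_iso (dsum M N) (dsum N M).
Proof.
by apply: (@rmod_iso_intro _ _ (lpair (lsnd M N) (lfst M N)) (lpair (lsnd N M) (lfst N M)))
  => -[x y].
Qed.
Lemma dsumA M N P : rmod_iso (dsum M (dsum N P)) (dsum (dsum M N) P).
Proof.
pose p1 := lfst M (dsum N P). pose p2 := lsnd M (dsum N P).
pose q1 := lfst (dsum M N) P. pose q2 := lsnd (dsum M N) P.
by apply: (@rmod_iso_intro _ _
   (lpair (lpair p1 (lcomp (lfst _ _) p2)) (lcomp (lsnd _ _) p2))
   (lpair (lcomp (lfst _ _) q1) (lpair (lcomp (lsnd _ _) q1) q2)))
  => [[x [y w]]|[[x y] w]].
Qed.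
Definition rmod0 : mod := 'rV[R^c]_0.
Lemma dsum0 M : rmod_iso (dsum rmod0 M) M.
Proof.
apply: (@rmod_iso_intro _ _ (lsnd _ _) (lpair (lzero _ _) (lid M))) => // -[x y] /=.
by congr pair; apply/rowP => -[].
Qed.

Definition summand M := exists (i : {linear M -> RR}) (p : {linear RR -> M}), cancel i p.

Lemma summand_retract M N (i : {linear M -> N}) (p : {linear N -> M}) :
  cancel i p -> summand N -> summand M.
Proof.
move=> iK [j [q jK]]; exists (lcomp j i), (lcomp p q) => x /=.
by rewrite jK iK.
Qed.
Lemma summand_iso M N : rmod_iso M N -> summand N -> summand M.
Proof. by case/rmod_iso_elim=> f [g [fK _]]; apply: (summand_retract fK). Qed.
Lemma summand_regular : summand RR.
Proof. by exists (lid _), (lid _) => x. Qed.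
Lemma summand_l M N : summand (dsum M N) -> summand M.
Proof.
by apply: (@summand_retract _ _ (lpair (lid M) (lzero M N)) (lfst M N)) => x.
Qed.
Lemma summand_r M N : summand (dsum M N) -> summand N.
Proof.
by apply: (@summand_retract _ _ (lpair (lzero N M) (lid N)) (lsnd M N)) => x.
Qed.

Lemma regular_lift M (x : M) : linear (fun r : RR => (r : R^c) *: x).
Proof. by move=> c u v; rewrite scalerDl scalerA. Qed.
Definition lgen M (x : M) : {linear RR -> M} :=
  HB.pack (fun r : RR => (r : R^c) *: x) (GRing.isLinear.Build _ _ _ _ _ (regular_lift x)).
Lemma regular_linearE M (f : {linear RR -> M}) x : f x = (x : R^c) *: f (1 : R).
Proof. by rewrite -linearZ /=; congr (f _); rewrite /GRing.scale /= mulr1. Qed.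

(** A summand of R_R is generated by the image of 1, and lifting that one element
    along a surjection lifts any map. *)
Lemma summand_FP M : summand M -> FP M.
Proof.
move=> [i [p iK]]; split.
  exists 1%N, (fun _ => p (1 : R)) => x; exists (fun _ => i x : R^c).
  by rewrite big_ord1 -[LHS]iK; exact: regular_linearE.
move=> N P g f gS; have [n gn] := gS (f (p (1 : R))).
exists (lcomp (lgen n) i) => x /=.
rewrite -[in RHS](iK x) (regular_linearE p) !linearZ /= gn.
by [].
Qed.

Definition lmul (a : R) : {linear RR -> RR} := lgen (a : RR).
Lemma lmulE a (x : R) : lmul a x = a * x. Proof. by []. Qed.
Lemma linear_lmul (f : {linear RR -> RR}) x : f x = (f (1 : R) : R) * x.
Proof. by rewrite regular_linearE. Qed.

Hypothesis Rreg : von_neumann_regular R.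

(** Between summands of R_R every map is a corner of a left multiplication, so
    regularity of R passes to maps. *)
Lemma summand_quasi_inverse M N (f : {linear M -> N}) : summand M -> summand N ->
  exists g : {linear N -> M}, (forall x, f (g (f x)) = f x) /\ (forall x, g (f (g x)) = g x).
Proof.
move=> [i [p iK]] [j [q jK]].
pose f' := lcomp j (lcomp f p); have [b fbf] := Rreg (f' (1 : R)).
pose g := lcomp p (lcomp (lmul b) j).
have f'E y : j (f (p y)) = (f' (1 : R) : R) * y by exact: (linear_lmul f').
have fE x : j (f x) = (f' (1 : R) : R) * i x by rewrite -f'E iK.
have fgf x : f (g (f x)) = f x.
  apply: (can_inj jK); rewrite [g _]/= f'E fE.
  by rewrite /GRing.scale /= !mulrA fbf.
by exists (lcomp g (lcomp f g)); split=> x /=; rewrite !fgf.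
Qed.

Lemma summand_complement M N (i : {linear N -> M}) (p : {linear M -> N}) : cancel i p ->
  exists (P : mod) (j : {linear P -> M}) (q : {linear M -> P}),
  [/\ cancel j q, forall x, p (j x) = 0 & forall x, i (p x) + j (q x) = x].
Proof.
move=> iK; pose e : {linear M -> M} := lsub (lid M) (lcomp i p).
have eE x : e x = x - i (p x) by [].
have pe x : p (e x) = 0 by rewrite eE linearB iK subrr.
have ee x : e (e x) = e x by rewrite {1}eE pe linear0 subr0.
have [P [j [q [jK jq]]]] := split_idempotent ee.
exists P, j, q; split=> // x; last by rewrite jq eE addrC subrK.
by rewrite -[x]jK jq pe.
Qed.
End Iso.

(** * Refinement and the monoid of isomorphism classes *)

Section Refine.
Variable R : pzRingType.
Local Notation mod := (rmodType R).
Implicit Types M N P Q : mod.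

Lemma split_dsum M N P (i : {linear N -> M}) (p : {linear M -> N})
    (j : {linear P -> M}) (q : {linear M -> P}) :
  cancel i p -> cancel j q -> (forall x, p (j x) = 0) ->
  (forall x, i (p x) + j (q x) = x) ->
  (forall x, q (i x) = 0) /\ rmod_iso M (dsum N P).
Proof.
move=> iK jK pj E; have qi x : q (i x) = 0.
  by apply: (can_inj jK); rewrite linear0; apply: (addrI (i x)); rewrite -{1}[x in i x]iK E addr0.
split=> //; apply: (@rmod_iso_intro _ _ _ (lpair p q)
  (ladd (lcomp i (lfst N P)) (lcomp j (lsnd N P)))) => [x|[x y]] /=; first exact: E.
by rewrite !linearD /= iK jK pj qi add0r addr0.
Qed.

Hypothesis Rreg : von_neumann_regular R.

(** Let pi : A -> D be the component of the isomorphism and g a quasi-inverse of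
    it.  The kernel K of pi is carried into C, and its complement A' in A is
    carried isomorphically into D by pi, so A = K + A', C = K + C', D = A' + D'.
    The complement of the graph-like image of A is then C' + D', and B is
    isomorphic to it. *)
Lemma rmod_refinement (A B C D : mod) :
  summand (dsum A B) -> rmod_iso (dsum A B) (dsum C D) ->
  exists AC AD BC BD : mod, [/\ rmod_iso A (dsum AC AD), rmod_iso B (dsum BC BD),
    rmod_iso C (dsum AC BC) & rmod_iso D (dsum AD BD)].
Proof.
move=> sAB isoE; have sCD := summand_iso (rmod_iso_sym isoE) sAB.
have [phi [psi [phiK psiK]]] := rmod_iso_elim isoE.
pose inA : {linear A -> dsum A B} := lpair (lid A) (lzero A B).
pose inB : {linear B -> dsum A B} := lpair (lzero B A) (lid B).
pose inC : {linear C -> dsum C D} := lpair (lid C) (lzero C D).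
pose phiA := lcomp phi inA.
pose pi : {linear A -> D} := lcomp (lsnd C D) phiA.
pose ga : {linear A -> C} := lcomp (lfst C D) phiA.
have [g [pgp gpg]] := summand_quasi_inverse Rreg pi (summand_l sAB) (summand_r sCD).
have [A' [i [p [iK ip]]]] : exists (A' : mod) (i : {linear A' -> A}) (p : {linear A -> A'}),
    cancel i p /\ forall x, i (p x) = g (pi x).
  by apply: (split_idempotent (e := lcomp g pi)) => x /=; rewrite gpg.
have [K [j [q [jK pj ipjq]]]] := summand_complement iK.
have [qi isoA] := split_dsum iK jK pj ipjq.
have pij x : pi (j x) = 0 by rewrite -pgp -ip pj !linear0.
have iDK : cancel (lcomp pi i) (lcomp p g) by move=> x /=; rewrite -ip !iK.
have [D' [jD [qD [jDK pjD EjD]]]] := summand_complement iDK.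
have [qiD isoD] := split_dsum iDK jDK pjD EjD.
have gaj x : phi (inA (j x)) = inC (ga (j x)).
  by rewrite [LHS]surjective_pairing; congr pair; exact: pij.
have iCK : cancel (lcomp ga j) (lcomp q (lcomp (lfst A B) (lcomp psi inC))).
  by move=> x /=; rewrite -[(_, _)]gaj phiK jK.
have [C' [jC [qC [jCK pjC EjC]]]] := summand_complement iCK.
have [qiC isoC] := split_dsum iCK jCK pjC EjC.
exists K, A', C', D'; split=> //.
  exact: rmod_iso_trans isoA (dsumC _ _).
(* G sends b to the class of phi b modulo phi A, in the representatives C' + D'. *)
pose c1 := lsub (lfst C D) (lcomp ga (lcomp g (lsnd C D))).
pose H := lpair (lcomp qC c1) (lcomp qD (lsnd C D)).
pose G : {linear B -> dsum C' D'} := lcomp H (lcomp phi inB).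
pose F : {linear dsum C' D' -> B} := lcomp (lsnd A B) (lcomp psi (lmap jC jD)).
have phiE a b : phi (a, b) = phi (inB b) + phi (inA a).
  by rewrite -linearD; congr (phi (_, _)); rewrite /= ?add0r ?addr0.
have phiAE a : phi (inA a) = (ga a, pi a) by exact: surjective_pairing.
have psi2 x a b : x = phi (a, b) -> (psi x).2 = b by move=> ->; rewrite phiK.
have GE b c d : phi (inB b) = (c, d) -> G b = (qC (c - ga (g d)), qD d).
  move=> E; rewrite -[G b]/(H (phi (inB b))) E; reflexivity.
have jqC c : jC (qC c) = c - ga (j (q (psi (inC c)).1)).
  by rewrite -{2}[c]EjC /= addrC addKr.
have jqD d : jD (qD d) = d - pi (g d).
  by rewrite -{2}[d]EjD /= ip gpg addrC addKr.
have jqK a : j (q a) = a - g (pi a) by rewrite -{2}[a]ipjq ip addrC addKr.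
exists G, F => [b|[c' d']].
  have [c [d Ecd]] : exists c d, phi (inB b) = (c, d).
    by exists (phi (inB b)).1, (phi (inB b)).2; exact: surjective_pairing.
  rewrite (GE _ _ _ Ecd).
  set k := j (q (psi (inC (c - ga (g d)))).1).
  have E1 : jC (qC (c - ga (g d))) = c + ga (- g d - k).
    by rewrite jqC -/k linearB linearN addrA.
  have E2 : jD (qD d) = d + pi (- g d - k).
    by rewrite jqD linearB linearN pij subr0.
  apply: (psi2 _ (- g d - k)); rewrite phiE Ecd phiAE.
  by congr pair; [exact: E1|exact: E2].
case Eab : (psi (jC c', jD d')) => [a b].
have {}Eab : phi (a, b) = (jC c', jD d') by rewrite -Eab psiK.
have -> : F (c', d') = b by apply: (psi2 _ a); rewrite Eab.
have Eb : phi (inB b) = (jC c' - ga a, jD d' - pi a).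
  by apply: (addIr (phi (inA a))); rewrite -phiE Eab phiAE; congr pair; rewrite /= subrK.
rewrite (GE _ _ _ Eb).
have E1 : qD (jD d' - pi a) = d'.
  suff qDpi : qD (pi a) = 0 by rewrite linearB jDK qDpi subr0.
  by apply: (can_inj jDK); rewrite jqD pgp subrr linear0.
have E2 : g (jD d' - pi a) = - g (pi a).
  have -> : g (jD d' - pi a) = g (jD d') - g (pi a) by exact: linearB.
  have -> : g (jD d') = 0; last by rewrite sub0r.
  by rewrite -[d']jDK jqD linearB gpg subrr.
have E3 : qC (jC c' - ga a - ga (g (jD d' - pi a))) = c'.
  have gj : lcomp ga j (q a) = ga a - ga (g (pi a)).
    by rewrite -linearB -jqK.
  have -> : jC c' - ga a - ga (g (jD d' - pi a)) = jC c' - lcomp ga j (q a).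
    by rewrite E2 gj linearN !opprB opprK addrAC addrA.
  by rewrite linearB jCK qiC subr0.
by congr pair.
Qed.
End Refine.

Section Classes.
Variable R : pzRingType.
Local Notation mod := (rmodType R).
Local Notation RR := (regular_rmod R).

(** Classes are taken as predicates on modules, so that isomorphism becomes
    Leibniz equality. *)
Definition iso_class := {X : mod -> Prop | exists M, X = @rmod_iso R M}.
Definition cls (M : mod) : iso_class := exist _ (@rmod_iso R M) (ex_intro _ M erefl).
Definition rep (X : iso_class) : mod := projT1 (cid (svalP X)).
Definition cls_add X Y := cls (dsum (rep X) (rep Y)).

Lemma repK X : cls (rep X) = X.
Proof.
rewrite /rep; case: (cid _) => M /= E; case: X E => X PX /= E.
by apply: eq_exist; rewrite E.
Qed.
Lemma clsP (M N : mod) : cls M = cls N <-> rmod_iso M N.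
Proof.
split=> [[/(congr1 (fun f => f N)) E]|iMN].
  have : rmod_iso N N by exact: rmod_iso_refl.
  by rewrite -E.
apply: eq_exist; apply/funext => P; apply/propext; split.
  exact: rmod_iso_trans (rmod_iso_sym iMN).
exact: rmod_iso_trans iMN.
Qed.
Lemma clsE (M N : mod) : rmod_iso M N = (cls M = cls N).
Proof. by apply/propext; split=> /clsP. Qed.
Lemma cls_dsum (M N : mod) : cls (dsum M N) = cls_add (cls M) (cls N).
Proof. by apply/clsP/dsum_iso; apply/clsP; rewrite repK. Qed.
Lemma cls_ind (P : iso_class -> Prop) : (forall M, P (cls M)) -> forall X, P X.
Proof. by move=> H X; rewrite -(repK X). Qed.
Lemma cls_addC X Y : cls_add X Y = cls_add Y X.
Proof. exact/clsP/dsumC. Qed.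
Lemma cls_addA X Y W : cls_add X (cls_add Y W) = cls_add (cls_add X Y) W.
Proof.
elim/cls_ind: X => X; elim/cls_ind: Y => Y; elim/cls_ind: W => W.
by rewrite -!cls_dsum; exact/clsP/dsumA.
Qed.
Lemma cls_add0 X : cls_add (cls (rmod0 R)) X = X.
Proof. by elim/cls_ind: X => X; rewrite -cls_dsum; exact/clsP/dsum0. Qed.

Hypothesis Rreg : von_neumann_regular R.
Lemma cls_refinement X Y Z W E : cls_add X Y = cls_add Z W ->
  cls_add (cls_add X Y) E = cls RR ->
  exists ac ad bc bd, [/\ X = cls_add ac ad, Y = cls_add bc bd, Z = cls_add ac bc
    & W = cls_add ad bd].
Proof.
elim/cls_ind: X => A; elim/cls_ind: Y => B; elim/cls_ind: Z => C; elim/cls_ind: W => D.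
elim/cls_ind: E => E; rewrite -!cls_dsum => /clsP isoE /clsP isoR.
have sAB : summand (dsum A B) by apply/summand_l/(summand_iso isoR)/summand_regular.
have [AC [AD [BC [BD [? ? ? ?]]]]] := rmod_refinement Rreg sAB isoE.
by exists (cls AC), (cls AD), (cls BC), (cls BD); rewrite -!cls_dsum; split; apply/clsP.
Qed.

Hypothesis Rcore : core_separative R.
Lemma cls_core X Y Z : cls_add (cls_add X Z) Z = cls RR ->
  cls_add (cls_add Y Z) Z = cls RR -> cls_add X Z = cls_add Y Z.
Proof.
elim/cls_ind: X => A; elim/cls_ind: Y => B; elim/cls_ind: Z => C.
rewrite -!cls_dsum => /clsP iA /clsP iB; apply/clsP.
have sA := summand_iso iA (summand_regular R).
have sB := summand_iso iB (summand_regular R).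
apply: Rcore; try apply: summand_FP.
- exact/summand_l/summand_l/sA.
- exact/summand_l/summand_l/sB.
- exact/summand_r/sA.
- exact: rmod_iso_sym.
- exact: rmod_iso_trans iA (rmod_iso_sym iB).
Qed.

Lemma module_exchange (x p q r k1 k2 n1 n2 : mod) :
  rmod_iso (dsum (dsum x p) k2) RR -> rmod_iso (dsum (dsum r q) k1) RR ->
  rmod_iso (dsum (dsum r p) n1) RR -> rmod_iso (dsum (dsum x q) n2) RR ->
  exists x0 x1 p00 t p1 q0 q1 k20 k21 k10 k11 n10 n11 n12 n20 n21 y m : mod,
    [/\ [/\ rmod_iso x (dsum x0 x1), rmod_iso p (dsum (dsum p00 t) p1)
          & rmod_iso q (dsum q0 q1)],
      [/\ rmod_iso k2 (dsum k20 k21), rmod_iso k1 (dsum k10 k11),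
          rmod_iso n1 (dsum (dsum n10 n11) n12) & rmod_iso n2 (dsum n20 n21)],
      rmod_iso (dsum q1 k11) (dsum t y) /\ rmod_iso (dsum x0 q0) (dsum n11 m),
      rmod_iso (dsum (dsum (dsum x1 p1) k21) t) (dsum (dsum (dsum r q0) k10) t)
    & rmod_iso (dsum (dsum (dsum r (dsum p00 t)) n10) n11)
        (dsum (dsum (dsum x1 q1) n21) n11)].
Proof.
rewrite !clsE !cls_dsum => H1 H2 H3 H4.
have [x0 [x1 [p00 [t [p1 [q0 [q1 [k20 [k21 [k10 [k11 [n10 [n11 [n12 [n20 [n21 [y [m H]]]]]]]]]]]]]]]]]]
  := monoid_exchange cls_addC cls_addA cls_add0 cls_refinement cls_core H1 H2 H3 H4.
exists (rep x0), (rep x1), (rep p00), (rep t), (rep p1), (rep q0), (rep q1), (rep k20),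
  (rep k21), (rep k10), (rep k11), (rep n10), (rep n11), (rep n12), (rep n20), (rep n21),
  (rep y), (rep m).
by rewrite !clsE !cls_dsum !repK.
Qed.
End Classes.

(** * Exchanging the pieces *)

Section Assembly.
Variable R : pzRingType.
Local Notation mod := (rmodType R).
Local Notation RR := (regular_rmod R).

(** The two components of the orthogonal map S1 + S2 -> R1 + R2 that is the
    identity on r, p, q, x. *)
Definition top_row (x p q r k1 k2 n1 : mod) (s1 : dsum (dsum r q) k1)
  (s2 : dsum (dsum x p) k2) : dsum (dsum r p) n1 := ((s1.1.1, s2.1.2), 0).
Definition bottom_row (x p q r k1 k2 n2 : mod) (s1 : dsum (dsum r q) k1)
  (s2 : dsum (dsum x p) k2) : dsum (dsum x q) n2 := ((s2.1.1, s1.1.2), 0).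

(** The module form of the condition [completing] below, with the whole of
    S1 + S2 in place of one column. *)
Definition reducible (x p q r k1 k2 n1 n2 : mod) :=
  exists (t : {linear dsum (dsum x p) k2 -> dsum (dsum r q) k1})
    (s : {linear dsum (dsum r q) k1 -> dsum (dsum x p) k2})
    (t' : {linear dsum (dsum r p) n1 -> dsum (dsum x q) n2})
    (e : {linear dsum (dsum x q) n2 -> dsum (dsum r p) n1}),
  (forall (s1 : dsum (dsum r q) k1) (s2 : dsum (dsum x p) k2), exists z y,
    top_row n1 s1 s2 = top_row n1 (t z) (z + s (t z)) + (y + e (t' y)) /\
    bottom_row n2 s1 s2 = bottom_row n2 (t z) (z + s (t z)) + t' y) /\
  (forall z y, top_row n1 (t z) (z + s (t z)) = y + e (t' y) ->
    bottom_row n2 (t z) (z + s (t z)) = t' y -> t' y = 0 /\ y + e (t' y) = 0).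

Local Notation "<| f , g |>" := (lpair f g).
Local Notation "f \; g" := (lcomp g f).

(** The column v is the identity on x0, p00, k20.  On x1 + p1 + k21 + t it is the
    exchange isomorphism f onto r + q0 + k10 + t, whose value is put in S1 except
    for its last component, which is put both in t inside S2 and, through ze, in
    q1 + k11 inside S1: the copy in S1 lets s recover the pieces that v has moved
    out of S2, so that the S2-component of v is 1 + s t.  The column v' is built
    in the same way from h and th, with n11 in the role of t. *)
Lemma fine_reducible (x0 x1 p00 t p1 q0 q1 k20 k21 k10 k11 n10 n11 n12 n20 n21 y m r : mod) :
  rmod_iso (dsum q1 k11) (dsum t y) -> rmod_iso (dsum x0 q0) (dsum n11 m) ->
  rmod_iso (dsum (dsum (dsum x1 p1) k21) t) (dsum (dsum (dsum r q0) k10) t) ->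
  rmod_iso (dsum (dsum (dsum r (dsum p00 t)) n10) n11) (dsum (dsum (dsum x1 q1) n21) n11) ->
  reducible (dsum x0 x1) (dsum (dsum p00 t) p1) (dsum q0 q1) r (dsum k10 k11)
    (dsum k20 k21) (dsum (dsum n10 n11) n12) (dsum n20 n21).
Proof.
move=> /rmod_iso_elim[ze [ze' [zeK ze'K]]] /rmod_iso_elim[th [th' [thK th'K]]].
move=> /rmod_iso_elim[f [f' [fK f'K]]] /rmod_iso_elim[h [h' [hK h'K]]].
set S1 := dsum (dsum r (dsum q0 q1)) (dsum k10 k11).
set S2 := dsum (dsum (dsum x0 x1) (dsum (dsum p00 t) p1)) (dsum k20 k21).
set R1 := dsum (dsum r (dsum (dsum p00 t) p1)) (dsum (dsum n10 n11) n12).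
set R2 := dsum (dsum (dsum x0 x1) (dsum q0 q1)) (dsum n20 n21).
(* F and Z are f and the embedded copy of t; T is the map t, S the map s, and
   tau, I undo Z, f on S1.  The same for H, Q, T', E, nu, J on the other side. *)
pose F : {linear S2 -> _} :=
  <| <| <| lfst _ _ \; lfst _ _ \; lsnd _ _, lfst _ _ \; lsnd _ _ \; lsnd _ _ |>,
     lsnd _ _ \; lsnd _ _ |>, lfst _ _ \; lsnd _ _ \; lfst _ _ \; lsnd _ _ |> \; f.
pose Z : {linear S2 -> _} := <| F \; lsnd _ _, lzero _ y |> \; ze'.
pose T : {linear S2 -> S1} :=
  <| <| F \; lfst _ _ \; lfst _ _ \; lfst _ _,
       <| F \; lfst _ _ \; lfst _ _ \; lsnd _ _, Z \; lfst _ _ |> |>,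
     <| F \; lfst _ _ \; lsnd _ _, Z \; lsnd _ _ |> |>.
pose tau : {linear S1 -> t} :=
  <| lfst _ _ \; lsnd _ _ \; lsnd _ _, lsnd _ _ \; lsnd _ _ |> \; ze \; lfst _ _.
pose I : {linear S1 -> _} :=
  <| <| <| lfst _ _ \; lfst _ _, lfst _ _ \; lsnd _ _ \; lfst _ _ |>,
       lsnd _ _ \; lfst _ _ |>, tau |> \; f'.
pose neg (M N : mod) (g : {linear M -> N}) := lsub (lzero M N) g.
pose S : {linear S1 -> S2} :=
  <| <| <| lzero _ _, neg _ _ (I \; lfst _ _ \; lfst _ _ \; lfst _ _) |>,
       <| <| lzero _ _, lsub tau (I \; lsnd _ _) |>,
          neg _ _ (I \; lfst _ _ \; lfst _ _ \; lsnd _ _) |> |>,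
     <| lzero _ _, neg _ _ (I \; lfst _ _ \; lsnd _ _) |> |>.
pose H : {linear R1 -> _} :=
  <| <| <| lfst _ _ \; lfst _ _, lfst _ _ \; lsnd _ _ \; lfst _ _ |>,
     lsnd _ _ \; lfst _ _ \; lfst _ _ |>, lsnd _ _ \; lfst _ _ \; lsnd _ _ |> \; h.
pose Q : {linear R1 -> _} := <| H \; lsnd _ _, lzero _ m |> \; th'.
pose T' : {linear R1 -> R2} :=
  <| <| <| Q \; lfst _ _, H \; lfst _ _ \; lfst _ _ \; lfst _ _ |>,
       <| Q \; lsnd _ _, H \; lfst _ _ \; lfst _ _ \; lsnd _ _ |> |>,
    <| lzero _ _, H \; lfst _ _ \; lsnd _ _ |> |>.
pose nu : {linear R2 -> n11} :=
  <| lfst _ _ \; lfst _ _ \; lfst _ _, lfst _ _ \; lsnd _ _ \; lfst _ _ |> \; th \; lfst _ _.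
pose J : {linear R2 -> _} :=
  <| <| <| lfst _ _ \; lfst _ _ \; lsnd _ _, lfst _ _ \; lsnd _ _ \; lsnd _ _ |>,
     lsnd _ _ \; lsnd _ _ |>, nu |> \; h'.
pose E : {linear R2 -> R1} :=
  <| <| neg _ _ (J \; lfst _ _ \; lfst _ _ \; lfst _ _),
      <| neg _ _ (J \; lfst _ _ \; lfst _ _ \; lsnd _ _), lzero _ _ |> |>,
    <| <| neg _ _ (J \; lfst _ _ \; lsnd _ _), lsub nu (J \; lsnd _ _) |>, lzero _ _ |> |>.
have IE X : I X = f' (((X.1.1, X.1.2.1), X.2.1), tau X) by [].
have SE X : S X = (((0, 0 - (I X).1.1.1), ((0, tau X - (I X).2), 0 - (I X).1.1.2)), (0, 0 - (I X).1.2)).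
  by [].
have JE X : J X = h' (((X.1.1.2, X.1.2.2), X.2.2), nu X) by [].
have EE X : E X = ((0 - (J X).1.1.1, (0 - (J X).1.1.2, 0)), ((0 - (J X).1.2, nu X - (J X).2), 0)).
  by [].
have pD (M N : mod) (a b : dsum M N) : a + b = (a.1 + b.1, a.2 + b.2) by [].
have th0 : th' (0, 0) = 0 by exact: (linear0 th').
have TE (z : S2) a0 a1 b00 bt b1 c0 c1 u v w i :
  z = (((a0, a1), ((b00, bt), b1)), (c0, c1)) ->
  f (((a1, b1), c1), bt) = (((u, v), w), i) ->
  T z = ((u, (v, (ze' (i, 0)).1)), (w, (ze' (i, 0)).2)) /\
  z + S (T z) = (((a0, 0), ((b00, i), 0)), (c0, 0)).
  move=> -> Ef.
  have ET : T (((a0, a1), ((b00, bt), b1)), (c0, c1)) =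
    ((u, (v, (ze' (i, 0)).1)), (w, (ze' (i, 0)).2)).
    by rewrite /T /Z /F /= Ef.
  split=> //; rewrite ET.
  have Etau : tau ((u, (v, (ze' (i, 0)).1)), (w, (ze' (i, 0)).2)) = i.
    by rewrite /tau /= -surjective_pairing ze'K.
  have EI : I ((u, (v, (ze' (i, 0)).1)), (w, (ze' (i, 0)).2)) = (((a1, b1), c1), bt).
    by rewrite IE Etau /= -Ef fK.
  rewrite SE EI Etau /=.
  by congr ((_, _), ((_, _), _), (_, _)); rewrite ?addr0 // ?sub0r ?subrr // addrC subrK.
have T'E (z : R1) u00 u v b1 c0 c1 c2 w1 w2 w3 i :
  z = ((u, ((u00, v), b1)), ((c0, c1), c2)) ->
  h (((u, (u00, v)), c0), c1) = (((w1, w2), w3), i) ->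
  T' z = ((((th' (i, 0)).1, w1), ((th' (i, 0)).2, w2)), (0, w3)) /\
  z + E (T' z) = ((0, ((0, 0), b1)), ((0, i), c2)).
  move=> -> Eh.
  have ET : T' ((u, ((u00, v), b1)), ((c0, c1), c2)) =
    ((((th' (i, 0)).1, w1), ((th' (i, 0)).2, w2)), (0, w3)).
    by rewrite /T' /Q /H /= Eh.
  split=> //; rewrite ET.
  have Enu : nu ((((th' (i, 0)).1, w1), ((th' (i, 0)).2, w2)), (0, w3)) = i.
    by rewrite /nu /= -surjective_pairing th'K.
  rewrite EE JE Enu /= -Eh hK /=.
  by congr ((_, ((_, _), _)), ((_, _), _)); rewrite ?addr0 // ?sub0r ?subrr // addrC subrK.
exists T, S, T', E; split.
(* r, q0, k10 and t are reached through f; what remains is p1, x1 and an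
   element of q1, which are reached through v'. *)
- move=> [[u [v v1]] [w w1]] [[[a0 a1] [[b00 bt] b1]] [c0 c1]].
  have Ef : f (f' (((u, v), w), bt)) = (((u, v), w), bt) by rewrite f'K.
  case: (f' _) Ef => [[[a1' b1'] c1'] bt'] Ef.
  pose z : S2 := (((a0, a1'), ((b00, bt'), b1')), (0, c1')).
  have [ET ES] := TE z _ _ _ _ _ _ _ _ _ _ _ erefl Ef.
  have Eh : h (h' (((a1, v1 - (ze' (bt, 0)).1), 0), 0)) = (((a1, v1 - (ze' (bt, 0)).1), 0), 0).
    by rewrite h'K.
  case: (h' _) Eh => [[[g [g00 gt]] d0] d1] Eh.
  pose y' : R1 := ((g, ((g00, gt), b1)), ((d0, d1), 0)).
  have [ET' EE'] := T'E y' _ _ _ _ _ _ _ _ _ _ _ erefl Eh.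
  exists z, y'; rewrite ES ET EE' ET' /top_row /bottom_row /= th0.
  split; rewrite !pD /= ?addr0 ?add0r //.
  by rewrite addrC subrK.
move=> z y2; move: {2}z (erefl z) => [[[a0 a1] [[b00 bt] b1]] [c0 c1]] Ez.
move: {2}y2 (erefl y2) => [[g [[g00 gt] g1]] [[d0 d1] d2]] Ey.
case Ef : (f (((a1, b1), c1), bt)) => [[[u v] w] i].
case Eh : (h (((g, (g00, gt)), d0), d1)) => [[[e1 e2] e3] j].
have [ET ES] := TE _ _ _ _ _ _ _ _ _ _ _ _ Ez Ef.
have [ET' EE'] := T'E _ _ _ _ _ _ _ _ _ _ _ _ Ey Eh.
rewrite ES ET EE' ET' /top_row /bottom_row /= => E1 E2.
(* In R1 the image of A v has components in r, p00, t and that of v' in p1, n11,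
   n12; comparing them leaves nothing on either side. *)
have Ei : i = 0 := congr1 (fun w : R1 => w.1.2.1.2) E1.
have <- : 0 = j := congr1 (fun w : R1 => w.2.1.2) E1.
have <- : 0 = g1 := congr1 (fun w : R1 => w.1.2.2) E1.
have <- : 0 = d2 := congr1 (fun w : R1 => w.2.2) E1.
have <- : 0 = e1 := congr1 (fun w : R2 => w.1.1.2) E2.
have <- : 0 = e3 := congr1 (fun w : R2 => w.2.2) E2.
have <- : (ze' (i, 0)).1 = e2 := congr1 (fun w : R2 => w.1.2.2) E2.
have -> : ze' (i, 0) = 0 by rewrite Ei; exact: (linear0 ze').
by rewrite th0.
Qed.
End Assembly.

(** * Elementary operations over a regular ring *)

Ltac zac :=
  match goal with |- @GRing.add ?T _ _ = _ =>
    ac_with (GRing.zero : T) (@GRing.add T) (@addrC T) (@addrA T) (@add0r T)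
  end.

Section Matrices.
Variable R : pzRingType.
Implicit Types a b c d e s t x y m h l g r z : R.

Lemma mx2_mul a b c d a' b' c' d' : mx2 a b c d *m mx2 a' b' c' d' =
  mx2 (a * a' + b * c') (a * b' + b * d') (c * a' + d * c') (c * b' + d * d').
Proof.
apply/matrixP => i j; rewrite !mxE !big_ord_recl big_ord0 !mxE /= addr0.
by case: (i == 0); case: (j == 0).
Qed.
Lemma mx2_eta (A : 'M[R]_2) : A = mx2 (A 0 0) (A 0 1) (A 1 0) (A 1 1).
Proof.
apply/matrixP => i j; rewrite mxE.
by case: i => [[|[|//]] i]; case: j => [[|[|//]] j] /=; congr (A _ _); apply: val_inj.
Qed.
Definition lower x : 'M[R]_2 := mx2 1 0 x 1.
Definition upper x : 'M[R]_2 := mx2 1 x 0 1.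
Lemma elementary_lower x : elementary (lower x). Proof. by exists x; right. Qed.
Lemma elementary_upper x : elementary (upper x). Proof. by exists x; left. Qed.
Lemma lowerD x y : lower x *m lower y = lower (x + y).
Proof. by rewrite mx2_mul !(mul0r, mulr0, mul1r, mulr1, addr0, add0r). Qed.
Lemma upperD x y : upper x *m upper y = upper (x + y).
Proof. by rewrite mx2_mul !(mul0r, mulr0, mul1r, mulr1, addr0, add0r) addrC. Qed.
Lemma mx2_diag a d : is_diag_mx (mx2 a 0 0 d).
Proof.
by apply/is_diag_mxP => i j; rewrite mxE; case: i => [[|[|//]] i]; case: j => [[|[|//]] j].
Qed.

Lemma clear_offdiagonal m h l g r z : h = r * g -> l = g * z ->
  upper (- r) *m mx2 m h l g *m lower (- z) = mx2 (m - r * l) 0 0 g.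
Proof.
move=> -> El; rewrite !mx2_mul !(mul0r, mulr0, mul1r, mulr1, addr0, add0r).
by rewrite !mulNr subrr mul0r addr0 mulrN El subrr.
Qed.

Hypothesis Rreg : von_neumann_regular R.

(** If g' is a quasi-inverse of g, then 1 - g' g is killed by g, hence by h, and
    h = (h g') g. *)
Lemma annihilator_factor (h g : R) : (forall z, g * z = 0 -> h * z = 0) -> exists r, h = r * g.
Proof.
move=> H; have [g' gg'g] := Rreg g; exists (h * g').
have := H (1 - g' * g); rewrite !mulrBr !mulr1 !mulrA gg'g subrr => /(_ erefl)/eqP.
by rewrite subr_eq0 => /eqP.
Qed.

(** The columns (t, 1 + s t) and (1 + e t', t') are the second column v of
    lower s *m upper t and the first column v' of upper e *m lower t'.  Writing
    A for the matrix of entries a, b, c, d, the condition says that the column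
    A (1, s) lies in A v R + v' R, and that A v R meets v' R in 0. *)
Definition completing a b c d s t e (t' : R) :=
  (exists z y, a + b * s = (a * t + b * (1 + s * t)) * z + (1 + e * t') * y /\
               c + d * s = (c * t + d * (1 + s * t)) * z + t' * y) /\
  (forall z y, (a * t + b * (1 + s * t)) * z = (1 + e * t') * y ->
               (c * t + d * (1 + s * t)) * z = t' * y -> t' * y = 0 /\ (1 + e * t') * y = 0).

(** In the bases given by v and v' the matrix has a bottom row (g z, g) and a
    top right entry h that is killed by the right annihilator of g; by regularity
    h = r g, so one more operation on each side clears both. *)
Lemma complete_reduction a b c d s t e (t' : R) :
  completing a b c d s t e t' ->
  exists x y, is_diag_mx
    (upper y *m (lower (- t') *m (upper (- e) *m mx2 a b c d *m lower s) *m upper t) *m lower x).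
Proof.
move=> [[z [y [E1 E2]]] H].
set b' := a * t + b * (1 + s * t) in E1 H; set d' := c * t + d * (1 + s * t) in E2 H.
have -> : lower (- t') *m (upper (- e) *m mx2 a b c d *m lower s) *m upper t =
  mx2 (a + b * s - e * (c + d * s)) (b' - e * d')
    (c + d * s - t' * (a + b * s - e * (c + d * s))) (d' - t' * (b' - e * d')).
  have E3 : a + - e * c + (b + - e * d) * s = a + b * s - e * (c + d * s).
    by rewrite mulrDl mulrDr !mulNr opprD mulrA -!addrA; congr (_ + _); rewrite addrCA.
  have E4 : (a + b * s - e * (c + d * s)) * t + (b - e * d) = b' - e * d'.
    rewrite /b' /d' !mulrDr !mulr1 !mulrBl !mulrDl !opprD !mulrA; zac.
  have E5 : (c + d * s) * t + d = d' by rewrite /d' mulrDl mulrDr mulr1 !mulrA; zac.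
  rewrite !mx2_mul !(mul0r, mulr0, mul1r, mulr1, addr0, add0r) E3.
  congr mx2; [by rewrite -E4 mulNr|by rewrite mulNr addrC|].
  rewrite -E4 -E5; move: (a + b * s - _) => al {E3 E4}.
  by rewrite mulrDl !mulNr !mulrDr !opprD !mulrA; zac.
have El : c + d * s - t' * (a + b * s - e * (c + d * s)) = (d' - t' * (b' - e * d')) * z.
  rewrite E1 E2 [e * (_ + _)]mulrDr [(1 + _) * y]mulrDl mul1r.
  have -> : b' * z + (y + e * t' * y) - (e * (d' * z) + e * (t' * y)) = (b' - e * d') * z + y.
    rewrite mulrBl opprD !mulrA.
    transitivity (b' * z - e * d' * z + y + (e * t' * y - e * t' * y)); first zac.
    by rewrite subrr addr0.
  by rewrite mulrDr opprD addrACA subrr addr0 [RHS]mulrBl -mulrA.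
have [r Er] : exists r, b' - e * d' = r * (d' - t' * (b' - e * d')).
  apply: annihilator_factor => w; rewrite mulrBl -!mulrA => /eqP; rewrite subr_eq0 => /eqP E.
  have Eb : b' * w = (1 + e * t') * ((b' - e * d') * w).
    by rewrite [(1 + _) * _]mulrDl mul1r -[e * t' * _]mulrA -E mulrBl -mulrA subrK.
  have [H1 H2] := H _ _ Eb E.
  by move: H2; rewrite [(1 + _) * _]mulrDl mul1r -[e * t' * _]mulrA H1 mulr0 addr0.
by exists (- z), (- r); rewrite (clear_offdiagonal _ Er El); exact: mx2_diag.
Qed.
End Matrices.

(** * Orthogonal matrices *)

Section Normal.
Variable R : pzRingType.
Local Notation mod := (rmodType R).
Local Notation RR := (regular_rmod R).
Hypothesis Rreg : von_neumann_regular R.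

Definition quasi_inverses (a a' : R) := a * a' * a = a /\ a' * a * a' = a'.

(** Placing a quasi-inverse between the idempotents g and f makes f w = 0 imply
    a' w = 0, and w g = 0 imply w a' = 0. *)
Lemma quasi_inverse_cut (f g a : R) : f * f = f -> g * g = g -> f * a = a -> a * g = a ->
  exists a', [/\ quasi_inverses a a', g * a' = a' & a' * f = a'].
Proof.
move=> ff gg fa ag; have [h aha] := Rreg a.
have haha : a * h * a * h = a * h by rewrite aha.
have E : g * h * a * h * f * a = g * h * a by rewrite -!mulrA fa !(mulrA a) aha.
exists (g * h * a * h * f); split; last by rewrite -mulrA ff.
  split; first by rewrite -mulrA E !mulrA ag aha.
  by rewrite E !mulrA -(mulrA _ a g) ag -!mulrA; congr (_ * (_ * _)); rewrite !mulrA aha.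
by rewrite !mulrA gg.
Qed.

(** In each row the two images, and in each column the two coimages, are
    independent. *)
Definition orthogonal_mx2 (a b c d : R) := exists a' b' c' d',
  [/\ [/\ quasi_inverses a a', quasi_inverses b b', quasi_inverses c c' & quasi_inverses d d'],
    a' * b = 0 /\ b' * a = 0, c' * d = 0 /\ d' * c = 0, a * c' = 0 /\ c * a' = 0
    & b * d' = 0 /\ d * b' = 0].

Lemma idem_compl (e : R) : e * e = e -> (1 - e) * (1 - e) = 1 - e.
Proof. by move=> ee; rewrite mulrBr mulr1 mulrBl mul1r ee subrr subr0. Qed.

(** Use d to cut c and b down to independent parts, then use the new b and c to
    cut a down.  The operations with b and c leave d, b, c unchanged by
    orthogonality, so there is one operation of each kind in total. *)
Lemma orthogonalize (A : 'M[R]_2) : exists s e a b c d,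
  upper e *m A *m lower s = mx2 a b c d /\ orthogonal_mx2 a b c d.
Proof.
rewrite [A]mx2_eta; move: (A 0 0) (A 0 1) (A 1 0) (A 1 1) => a0 b0 c0 d {A}.
have [d' [[dK d'K] _ _]] := quasi_inverse_cut (mulr1 1) (mulr1 1) (mul1r d) (mulr1 d).
pose f := 1 - d * d'; pose g := 1 - d' * d.
have ff : f * f = f by apply: idem_compl; rewrite mulrA dK.
have gg : g * g = g by apply: idem_compl; rewrite mulrA d'K.
have fd : f * d = 0 by rewrite mulrBl mul1r dK subrr.
have d'f : d' * f = 0 by rewrite mulrBr mulr1 mulrA d'K subrr.
have gd' : g * d' = 0 by rewrite mulrBl mul1r d'K subrr.
have dg : d * g = 0 by rewrite mulrBr mulr1 mulrA dK subrr.
pose c := f * c0; pose b := b0 * g.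
have [b' [[bK b'K] gb' _]] : exists b', [/\ quasi_inverses b b', g * b' = b' & b' * 1 = b'].
  by apply: quasi_inverse_cut; rewrite ?mulr1 ?mul1r // -mulrA gg.
have [c' [[cK c'K] _ c'f]] : exists c', [/\ quasi_inverses c c', 1 * c' = c' & c' * f = c'].
  by apply: quasi_inverse_cut; rewrite ?mulr1 ?mul1r // mulrA ff.
have bd' : b * d' = 0 by rewrite -mulrA gd' mulr0.
have db' : d * b' = 0 by rewrite -gb' mulrA dg mul0r.
have d'c : d' * c = 0 by rewrite mulrA d'f mul0r.
have c'd : c' * d = 0 by rewrite -c'f -mulrA fd mulr0.
pose a1 := a0 - b0 * d' * c0.
pose k := 1 - b * b'; pose l := 1 - c' * c.
have kk : k * k = k by apply: idem_compl; rewrite mulrA bK.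
have ll : l * l = l by apply: idem_compl; rewrite mulrA c'K.
have kb : k * b = 0 by rewrite mulrBl mul1r bK subrr.
have b'k : b' * k = 0 by rewrite mulrBr mulr1 mulrA b'K subrr.
have lc' : l * c' = 0 by rewrite mulrBl mul1r c'K subrr.
have cl : c * l = 0 by rewrite mulrBr mulr1 mulrA cK subrr.
pose a := k * a1 * l.
have [a' [[aK a'K] la' a'k]] : exists a', [/\ quasi_inverses a a', l * a' = a' & a' * k = a'].
  by apply: quasi_inverse_cut => //; rewrite ?mulrA ?kk // -mulrA ll.
exists (- (d' * c0) - b' * a1), (- (k * a1 * c') - b0 * d'), a, b, c, d; split.
  have E1 : upper (- (b0 * d')) *m mx2 a0 b0 c0 d *m lower (- (d' * c0)) = mx2 a1 b c d.
    rewrite !mx2_mul !(mul0r, mulr0, mul1r, mulr1, addr0, add0r).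
    have -> : b0 + - (b0 * d') * d = b by rewrite /b mulrBr mulr1 mulNr mulrA.
    have Ec : c0 + d * - (d' * c0) = c by rewrite /c mulrBl mul1r mulrN mulrA.
    by congr mx2 => //; rewrite mulrN [b * _]mulrA bd' mul0r subr0 mulNr.
  rewrite -lowerD -upperD !mulmxA -(mulmxA (upper (- (k * _ * _)))).
  rewrite -(mulmxA (upper (- (k * _ * _)))) E1.
  rewrite !mx2_mul !(mul0r, mulr0, mul1r, mulr1, addr0, add0r).
  have E2 : k * a1 * c' * d = 0 by rewrite -mulrA c'd mulr0.
  rewrite !mulNr E2 subr0; congr mx2 => //.
  - rewrite /a /l [RHS]mulrBr mulr1 [in RHS]mulrA mulrN addrAC; congr (_ - _).
    by rewrite /k mulrBl mul1r !mulrA.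
  - by rewrite mulrN mulrA db' mul0r subr0.
exists a', b', c', d'; split=> //; split=> //.
- by rewrite -a'k -mulrA kb mulr0.
- by rewrite /a !mulrA b'k !mul0r.
- by rewrite -mulrA lc' mulr0.
- by rewrite -la' mulrA cl mul0r.
Qed.
End Normal.

(** * Three row and three column operations suffice *)

Section Reduction.
Variable R : pzRingType.
Local Notation mod := (rmodType R).
Local Notation RR := (regular_rmod R).

Lemma right_ideal_split (u u' : R) : quasi_inverses u u' ->
  exists (M : mod) (i : {linear M -> RR}) (p : {linear RR -> M}),
    cancel i p /\ forall y : R, i (p y) = u' * u * y.
Proof.
case=> uK u'K; apply: (split_idempotent (e := lmul (u' * u))) => x.
by rewrite !lmulE !mulrA u'K.
Qed.

(** Independent images u R and v R and a complement decompose R_R.  With u, v the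
    entries of a row this describes R1 or R2; with the idempotents u' u and v' v
    of the entries of a column it describes S1 or S2. *)
Lemma frame (u u' v v' : R) (M N : mod) (i : {linear M -> RR}) (p : {linear RR -> M})
    (j : {linear N -> RR}) (q : {linear RR -> N}) :
  quasi_inverses u u' -> quasi_inverses v v' -> u' * v = 0 -> v' * u = 0 ->
  cancel i p -> (forall y : R, i (p y) = u' * u * y) ->
  cancel j q -> (forall y : R, j (q y) = v' * v * y) ->
  exists (P : mod) (rho : {linear RR -> dsum (dsum M N) P}) (rho' : {linear _ -> RR}),
    [/\ cancel rho rho', cancel rho' rho,
      forall y z : R, rho (u * y + v * z) = ((p y, q z), 0)
    & forall y : R, (rho y).1 = (p (u' * y), q (v' * y))].
Proof.
move=> [uK u'K] [vK v'K] u'v v'u iK ip jK jq.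
have pE y : p (u' * u * y) = p y by rewrite -ip iK.
have qE y : q (v' * v * y) = q y by rewrite -jq jK.
have iE y : u' * u * i y = i y by rewrite -[y in RHS]iK ip.
have jE y : v' * v * j y = j y by rewrite -[y in RHS]jK jq.
pose e := 1 - u * u' - v * v'.
have eu : e * u = 0 by rewrite /e !mulrBl mul1r uK -mulrA v'u mulr0 subrr subr0.
have ev : e * v = 0 by rewrite /e !mulrBl mul1r vK -mulrA u'v mulr0 subr0 subrr.
have u'e : u' * e = 0 by rewrite /e !mulrBr mulr1 !mulrA u'K u'v mul0r subrr subr0.
have v'e : v' * e = 0 by rewrite /e !mulrBr mulr1 !mulrA v'K v'u mul0r subr0 subrr.
have ee : e * e = e by rewrite {2}/e !mulrBr mulr1 !mulrA eu ev !mul0r !subr0.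
have [P [k [w [kK kw]]]] : exists (P : mod) (k : {linear P -> RR}) (w : {linear RR -> P}),
    cancel k w /\ forall y, k (w y) = lmul e y.
  by apply: split_idempotent => x; rewrite !lmulE mulrA ee.
have wE (y : R) : w (e * y) = w y by rewrite -[e * y]kw kK.
have kE y : e * k y = k y by rewrite -[y in RHS]kK kw.
pose rho : {linear RR -> dsum (dsum M N) P} :=
  lpair (lpair (lcomp p (lmul u')) (lcomp q (lmul v'))) w.
pose rho' : {linear dsum (dsum M N) P -> RR} :=
  ladd (ladd (lcomp (lmul u) (lcomp i (lcomp (lfst M N) (lfst _ P))))
             (lcomp (lmul v) (lcomp j (lcomp (lsnd M N) (lfst _ P)))))
       (lcomp k (lsnd _ P)).
have rhoE y : rho y = ((p (u' * y), q (v' * y)), w y) by [].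
have rho'E m n x : rho' ((m, n), x) = u * i m + v * j n + k x by [].
exists P, rho, rho'; split=> //.
- move=> y; rewrite rhoE rho'E ip jq kw lmulE !mulrA uK vK /e !mulrBl mul1r.
  by rewrite -addrA [X in _ + X]addrC subrK addrC subrK.
- move=> [[m n] x]; rewrite rho'E rhoE.
  have -> : p (u' * (u * i m + v * j n + k x)) = m.
    by rewrite -(kE x) !mulrDr !mulrA iE u'v u'e !mul0r !addr0 iK.
  have -> : q (v' * (u * i m + v * j n + k x)) = n.
    by rewrite -(kE x) !mulrDr !mulrA jE v'u v'e !mul0r add0r addr0 jK.
  by rewrite -wE !mulrDr !mulrA eu ev !mul0r !add0r kE kK.
- move=> y z; rewrite rhoE; congr ((_, _), _).
  + by rewrite mulrDr !mulrA u'v mul0r addr0 pE.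
  + by rewrite mulrDr !mulrA v'u mul0r add0r qE.
  + by rewrite -wE mulrDr !mulrA eu ev !mul0r addr0 linear0.
Qed.

(** Maps between copies of R_R are left multiplications by ring elements. *)
Lemma reducible_transport (x p q r k1 k2 n1 n2 : mod)
    (s1 : {linear RR -> dsum (dsum r q) k1}) (s1' : {linear dsum (dsum r q) k1 -> RR})
    (s2 : {linear RR -> dsum (dsum x p) k2}) (s2' : {linear dsum (dsum x p) k2 -> RR})
    (r1 : {linear RR -> dsum (dsum r p) n1}) (r1' : {linear dsum (dsum r p) n1 -> RR})
    (r2 : {linear RR -> dsum (dsum x q) n2}) (r2' : {linear dsum (dsum x q) n2 -> RR})
    (a b c d : R) :
  cancel s1 s1' -> cancel s1' s1 -> cancel s2 s2' -> cancel s2' s2 ->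
  cancel r1 r1' -> cancel r1' r1 -> cancel r2 r2' -> cancel r2' r2 ->
  (forall y z : R, r1 (a * y + b * z) = top_row n1 (s1 y) (s2 z)) ->
  (forall y z : R, r2 (c * y + d * z) = bottom_row n2 (s1 y) (s2 z)) ->
  reducible x p q r k1 k2 n1 n2 ->
  exists s t e t' : R, completing a b c d s t e t'.
Proof.
move=> s1K s1'K s2K s2'K r1K r1'K r2K r2'K top bot [T [S [T' [E [H1 H2]]]]].
pose lt := lcomp s1' (lcomp T s2); pose ls := lcomp s2' (lcomp S s1).
pose lt' := lcomp r2' (lcomp T' r1); pose le := lcomp r1' (lcomp E r2).
pose t : R := lt (1 : R); pose s : R := ls (1 : R).
pose t' : R := lt' (1 : R); pose e : R := le (1 : R).
have tE (y : R) : s1 (t * y) = T (s2 y) by rewrite -(linear_lmul lt) /= s1'K.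
have sE (y : R) : s2 (s * y) = S (s1 y) by rewrite -(linear_lmul ls) /= s2'K.
have t'E (y : R) : r2 (t' * y) = T' (r1 y) by rewrite -(linear_lmul lt') /= r2'K.
have eE (y : R) : r1 (e * y) = E (r2 y) by rewrite -(linear_lmul le) /= r1'K.
have wE (z : R) : s2 ((1 + s * t) * z) = s2 z + S (T (s2 z)).
  by rewrite mulrDl mul1r -mulrA [LHS]linearD sE tE.
have w'E (z : R) : r1 ((1 + e * t') * z) = r1 z + E (T' (r1 z)).
  by rewrite mulrDl mul1r -mulrA [LHS]linearD eE t'E.
have topv (z : R) : r1 ((a * t + b * (1 + s * t)) * z) =
    top_row n1 (T (s2 z)) (s2 z + S (T (s2 z))).
  by rewrite mulrDl -!mulrA top tE wE.
have botv (z : R) : r2 ((c * t + d * (1 + s * t)) * z) =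
    bottom_row n2 (T (s2 z)) (s2 z + S (T (s2 z))).
  by rewrite mulrDl -!mulrA bot tE wE.
exists s, t, e, t'; split.
  have [z [y [E1 E2]]] := H1 (s1 (1 : R)) (s2 s).
  exists (s2' z), (r1' y); split.
    apply: (can_inj r1K); rewrite -[a in LHS]mulr1 top E1 [RHS]linearD topv w'E.
    by rewrite s2'K r1'K.
  apply: (can_inj r2K); rewrite -[c in LHS]mulr1 bot E2 [RHS]linearD botv t'E.
  by rewrite s2'K r1'K.
move=> z y /(congr1 r1); rewrite topv w'E => E1 /(congr1 r2); rewrite botv t'E => E2.
have [H3 H4] := H2 _ _ E1 E2.
split; first by apply: (can_inj r2K); rewrite t'E H3 linear0.
by apply: (can_inj r1K); rewrite w'E H4 linear0.
Qed.

Lemma iso_linear (M N : mod) : rmod_iso M N ->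
  {f : {linear M -> N} & {g : {linear N -> M} | cancel f g /\ cancel g f}}.
Proof. by move=> /rmod_iso_elim H; case/cid: H => f /cid[g fg]; exists f, g. Qed.

Hypothesis Rreg : von_neumann_regular R.
Hypothesis Rcore : core_separative R.

Lemma orthogonal_reduction (a b c d : R) : orthogonal_mx2 a b c d ->
  exists s t e t' : R, completing a b c d s t e t'.
Proof.
move=> [a' [b' [c' [d' [[qa qb qc qd] [a'b b'a] [c'd d'c] [ac' ca'] [bd' db']]]]]].
have qi (u u' : R) : quasi_inverses u u' -> quasi_inverses (u' * u) (u' * u).
  by case=> uK u'K; split; rewrite !mulrA !u'K.
have [r [ir [pr [irK ipr]]]] := right_ideal_split qa.
have [p [ip [pp [ipK ipp]]]] := right_ideal_split qb.
have [q [iq [pq [iqK ipq]]]] := right_ideal_split qc.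
have [x [ix [px [ixK ipx]]]] := right_ideal_split qd.
have sq (u u' : R) (M : mod) (i : {linear M -> RR}) (f : {linear RR -> M}) :
    quasi_inverses u u' -> (forall y : R, i (f y) = u' * u * y) ->
    forall y : R, i (f y) = (u' * u) * (u' * u) * y.
  by move=> [uK u'K] E y; rewrite E !mulrA u'K.
have m0 (u v w1 w2 : R) : u * v = 0 -> w1 * u * (v * w2) = 0.
  by move=> uv; rewrite mulrA -(mulrA w1) uv mulr0 mul0r.
have [k1 [s1 [s1' [s1K s1'K _ s1E]]]] := frame (qi _ _ qa) (qi _ _ qc)
  (m0 _ _ _ _ ac') (m0 _ _ _ _ ca') irK (sq _ _ _ _ _ qa ipr) iqK (sq _ _ _ _ _ qc ipq).
have [k2 [s2 [s2' [s2K s2'K _ s2E]]]] := frame (qi _ _ qd) (qi _ _ qb)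
  (m0 _ _ _ _ db') (m0 _ _ _ _ bd') ixK (sq _ _ _ _ _ qd ipx) ipK (sq _ _ _ _ _ qb ipp).
have [n1 [r1 [r1' [r1K r1'K r1E _]]]] := frame qa qb a'b b'a irK ipr ipK ipp.
have [n2 [r2 [r2' [r2K r2'K r2E _]]]] := frame qd qc d'c c'd ixK ipx iqK ipq.
have pE (u u' : R) (M : mod) (i : {linear M -> RR}) (f : {linear RR -> M}) :
  quasi_inverses u u' -> cancel i f -> (forall y : R, i (f y) = u' * u * y) ->
  forall y, f (u' * u * y) = f y by move=> _ iK E y; rewrite -E iK.
have top (y z : R) : r1 (a * y + b * z) = top_row n1 (s1 y) (s2 z).
  by rewrite r1E /top_row s1E s2E /= (pE _ _ _ _ _ qa irK) // (pE _ _ _ _ _ qb ipK).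
have bot (y z : R) : r2 (c * y + d * z) = bottom_row n2 (s1 y) (s2 z).
  rewrite addrC r2E /bottom_row s1E s2E /= (pE _ _ _ _ _ qd ixK) //.
  by rewrite (pE _ _ _ _ _ qc iqK).
have [x0 [x1 [p00 [t [p1 [q0 [q1 [k20 [k21 [k10 [k11 [n10 [n11 [n12 [n20 [n21 [y [m H]]]]]]]]]]]]]]]]]]
  := module_exchange Rreg Rcore (rmod_iso_intro s2'K s2K) (rmod_iso_intro s1'K s1K)
    (rmod_iso_intro r1'K r1K) (rmod_iso_intro r2'K r2K).
case: H => -[/iso_linear[fx [gx [fxK gxK]]] /iso_linear[fp [gp [fpK gpK]]]
  /iso_linear[fq [gq [fqK gqK]]]] [/iso_linear[fk2 [gk2 [fk2K gk2K]]]
  /iso_linear[fk1 [gk1 [fk1K gk1K]]] /iso_linear[fn1 [gn1 [fn1K gn1K]]]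
  /iso_linear[fn2 [gn2 [fn2K gn2K]]]] [H1 H2] H3 H4.
have := @fine_reducible _ _ _ _ _ _ _ _ k20 _ _ _ _ _ n12 n20 _ _ _ _ H1 H2 H3 H4.
have canm (M N P Q : mod) (f : {linear M -> N}) (g : {linear P -> Q})
    (f' : {linear N -> M}) (g' : {linear Q -> P}) :
  cancel f f' -> cancel g g' -> cancel (lmap f g) (lmap f' g').
  by move=> fK gK [w1 w2] /=; rewrite fK gK.
have compK (M N P : mod) (f : {linear N -> P}) (g : {linear M -> N})
    (f' : {linear P -> N}) (g' : {linear N -> M}) :
  cancel f f' -> cancel g g' -> cancel (lcomp f g) (lcomp g' f').
  by move=> fK gK w /=; rewrite fK gK.
have idK (M : mod) : cancel (lid M) (lid M) by move=> w.
apply: (@reducible_transport _ _ _ _ _ _ _ _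
  (lcomp (lmap (lmap (lid r) fq) fk1) s1) (lcomp s1' (lmap (lmap (lid r) gq) gk1))
  (lcomp (lmap (lmap fx fp) fk2) s2) (lcomp s2' (lmap (lmap gx gp) gk2))
  (lcomp (lmap (lmap (lid r) fp) fn1) r1) (lcomp r1' (lmap (lmap (lid r) gp) gn1))
  (lcomp (lmap (lmap fx fq) fn2) r2) (lcomp r2' (lmap (lmap gx gq) gn2)));
  try by apply: compK => //; apply: (canm) => //; apply: canm.
- by move=> w z; rewrite /= top /top_row /= linear0.
- by move=> w z; rewrite /= bot /bottom_row /= linear0.
Qed.

Lemma three_three_reduction (A : 'M[R]_2) :
  exists E1 E2 E3 F1 F2 F3 : 'M[R]_2,
    (elementary E1 /\ elementary E2 /\ elementary E3) /\
    (elementary F1 /\ elementary F2 /\ elementary F3) /\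
    is_diag_mx (E3 *m E2 *m E1 *m A *m F1 *m F2 *m F3).
Proof.
have [s0 [e0 [a [b [c [d [EA orth]]]]]]] := orthogonalize Rreg A.
have [s [t [e [t' compl]]]] := orthogonal_reduction orth.
have [x [y diag]] := complete_reduction Rreg compl.
exists (upper (- e + e0)), (lower (- t')), (upper y), (lower (s0 + s)), (upper t), (lower x).
split; first by split; [exact: elementary_upper | split; [exact: elementary_lower | exact: elementary_upper]].
split; first by split; [exact: elementary_lower | split; [exact: elementary_upper | exact: elementary_lower]].
by rewrite -upperD -lowerD; move: diag; rewrite -EA !mulmxA.
Qed.
End Reduction.

(** * Local endomorphisms of a space of functions *)

Section Glue.
Definition branch := nat -> nat.
Definition glue n (y x : branch) : branch := fun i => if (i < n)%N then y i else x i.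
Definition same_head n (x y : branch) := forall i, (i < n)%N -> x i = y i.
Lemma glue_head n y x : same_head n (glue n y x) y.
Proof. by move=> i lin; rewrite /glue lin. Qed.
Lemma glue_glue n z y x : glue n z (glue n y x) = glue n z x.
Proof. by apply/funext => i; rewrite /glue; case: (i < n)%N. Qed.
Lemma glue_l n z y x : glue n (glue n z y) x = glue n z x.
Proof. by apply/funext => i; rewrite /glue; case: (i < n)%N. Qed.
Lemma glue_same n y x : same_head n x y -> glue n y x = x.
Proof. by move=> E; apply/funext => i; rewrite /glue; case: ifP => // /E. Qed.
End Glue.

Definition fn := branch -> bool.
Definition fadd (u v : fn) : fn := fun x => u x (+) v x.
Definition fzero : fn := fun _ => false.
Lemma faddA : associative fadd.
Proof. by move=> u v w; apply/funext => x; rewrite /fadd addbA. Qed.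
Lemma faddC : commutative fadd.
Proof. by move=> u v; apply/funext => x; rewrite /fadd addbC. Qed.
Lemma fadd0 : left_id fzero fadd.
Proof. by move=> u; apply/funext => x. Qed.
Lemma faddN : left_inverse fzero id fadd.
Proof. by move=> u; apply/funext => x; rewrite /fadd addbb. Qed.

(** The map a acts through the first n variables only: its value at x is computed
    from v with the other variables frozen at their values in x, and what it then
    does depends on the first n variables of x. *)
Definition local n (a : fn -> fn) := forall v x x', same_head n x x' ->
  a v x = a (fun y => v (glue n y x)) x'.

Lemma local_le m n a : (m <= n)%N -> local m a -> local n a.
Proof.
move=> lmn la v x x' E.
have E' : same_head m x x' by move=> i lim; apply: E; apply: leq_trans lmn.
rewrite (la _ _ _ E') [RHS](la _ x' x') //; congr (a _ x'); apply/funext => y; congr v.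
apply/funext => i; rewrite /glue; case: (ltnP i n) => lin.
  by case: ifP => // _; exact: E.
by rewrite ltnNge (leq_trans lmn lin).
Qed.

(** A local map commutes with freezing the remaining variables. *)
Lemma local_glue n a v x : local n a -> a (fun y => v (glue n y x)) = fun y => a v (glue n y x).
Proof.
move=> la; apply/funext => y; rewrite [RHS](la _ _ _ (@glue_head n y x)).
by congr (a _ y); apply/funext => z; rewrite glue_glue.
Qed.

Record local_endo := LocalEndo { op :> fn -> fn;
  opD : forall u v, op (fadd u v) = fadd (op u) (op v);
  op_local : exists n, local n op }.
HB.instance Definition _ := gen_eqMixin local_endo.
HB.instance Definition _ := gen_choiceMixin local_endo.

Lemma local_endoP (a b : local_endo) : (forall v x, a v x = b v x) -> a = b.
Proof.
move=> E; have {}E : op a = op b by apply/funext => v; apply/funext => x.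
by case: a b E => [f Df Lf] [g Dg Lg] /= E; subst g; congr LocalEndo; exact: Prop_irrelevance.
Qed.

Lemma common_local (a b : local_endo) : exists n, local n a /\ local n b.
Proof.
have [m la] := op_local a; have [n lb] := op_local b; exists (maxn m n).
by split; [apply: local_le la; exact: leq_maxl|apply: local_le lb; exact: leq_maxr].
Qed.

Program Definition lendo0 := @LocalEndo (fun _ => fzero) _ _.
Next Obligation. by exists 0%N. Qed.
Program Definition lendo1 := @LocalEndo id _ _.
Next Obligation. by exists 0%N => v x x' _; congr v; apply/funext. Qed.
Program Definition lendo_add (a b : local_endo) := @LocalEndo (fun v => fadd (a v) (b v)) _ _.
Next Obligation. by rewrite !opD !faddA -[fadd (fadd (a u) _) _]faddA (faddC (a v)) !faddA. Qed.
Next Obligation.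
have [n [la lb]] := common_local a b; exists n => v x x' E.
by rewrite /fadd (la _ _ _ E) (lb _ _ _ E).
Qed.
Program Definition lendo_mul (a b : local_endo) := @LocalEndo (fun v => a (b v)) _ _.
Next Obligation. by rewrite !opD. Qed.
Next Obligation.
have [n [la lb]] := common_local a b; exists n => v x x' E.
by rewrite (la _ _ _ E) (local_glue v x lb).
Qed.

Lemma lendo_addA : associative lendo_add.
Proof. by move=> a b c; apply: local_endoP => v x; rewrite /= faddA. Qed.
Lemma lendo_addC : commutative lendo_add.
Proof. by move=> a b; apply: local_endoP => v x; rewrite /= faddC. Qed.
Lemma lendo_add0 : left_id lendo0 lendo_add.
Proof. by move=> a; apply: local_endoP => v x. Qed.
Lemma lendo_addN : left_inverse lendo0 id lendo_add.
Proof. by move=> a; apply: local_endoP => v x; rewrite /= faddN. Qed.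
HB.instance Definition _ := GRing.isZmodule.Build local_endo lendo_addA lendo_addC lendo_add0 lendo_addN.
Lemma lendo_mulA : associative lendo_mul.
Proof. by move=> a b c; apply: local_endoP => v x. Qed.
Lemma lendo_mul1 : left_id lendo1 lendo_mul.
Proof. by move=> a; apply: local_endoP => v x. Qed.
Lemma lendo_1mul : right_id lendo1 lendo_mul.
Proof. by move=> a; apply: local_endoP => v x. Qed.
Lemma lendo_mulDl : left_distributive lendo_mul lendo_add.
Proof. by move=> a b c; apply: local_endoP => v x. Qed.
Lemma lendo_mulDr : right_distributive lendo_mul lendo_add.
Proof. by move=> a b c; apply: local_endoP => v x; rewrite /= opD. Qed.
HB.instance Definition _ := GRing.Zmodule_isPzRing.Build local_endo
  lendo_mulA lendo_mul1 lendo_1mul lendo_mulDl lendo_mulDr.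

(** * Regularity of the ring of local endomorphisms *)

(** An additive g with a g a = a, found by Zorn's lemma among the graphs of
    additive partial maps.  Addition has exponent 2, so closure under addition is
    all that an additive relation needs. *)
Section Inverse.
Variable a : fn -> fn.
Hypothesis aD : forall u v, a (fadd u v) = fadd (a u) (a v).
Implicit Types G : fn * fn -> Prop.

Definition partial_section G :=
  [/\ forall y x y' x', G (y, x) -> G (y', x') -> G (fadd y y', fadd x x'),
      forall x x' y, G (y, x) -> G (y, x') -> x = x'
    & forall y x w, G (y, x) -> y = a w -> a x = y].
(** Adjoining the zero pair keeps the union of the empty chain admissible. *)
Definition with_zero G p := p = (fzero, fzero) \/ G p.

Lemma faddK u v : fadd u (fadd u v) = v.
Proof. by rewrite faddA faddN fadd0. Qed.
Lemma additive0 : a fzero = fzero.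
Proof. by rewrite -{1}[fzero]fadd0 aD -{2}[a _]/(id _) faddN. Qed.

(** To define the partial map at a new y: if some y + d with d in the domain is a
    value a w, the value at y is forced up to the kernel of a to be w plus the
    value at d; otherwise it is arbitrary. *)
Lemma section_extend G y : G (fzero, fzero) -> partial_section G ->
  (forall x, ~ G (y, x)) -> exists x0,
  partial_section (fun p => exists d c, G (d, c) /\
    (p = (d, c) \/ p = (fadd y d, fadd x0 c))).
Proof.
move=> G0 [GD Gf Ga] noy.
have [x0 Hx0] : exists x0, forall d c w, G (d, c) -> fadd y d = a w ->
    a (fadd x0 c) = fadd y d.
  have [[d [c [w [Gdc E]]]]|none] := pselect (exists d c w, G (d, c) /\ fadd y d = a w);
    last by exists fzero => d c w Gdc E; case: none; exists d, c, w.
  exists (fadd w c) => d' c' w' Gdc' E'.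
  have Es : fadd d d' = a (fadd w w').
    by rewrite aD -E -E'; apply/funext => i; rewrite /fadd; case: (y i); case: (d i); case: (d' i).
  rewrite -faddA aD -E (Ga _ _ _ (GD _ _ _ _ Gdc Gdc') Es).
  by apply/funext => i; rewrite /fadd; case: (y i); case: (d i); case: (d' i).
have mixed d c d' c' : G (d, c) -> G (d', c') -> d = fadd y d' -> False.
  move=> H H' E; apply: (noy (fadd c c')).
  have -> : y = fadd d d' by rewrite E -faddA faddN faddC fadd0.
  exact: GD.
exists x0; split.
- move=> y1 x1 y2 x2 [d [c [H D]]] [d' [c' [H' D']]].
  exists (fadd d d'), (fadd c c'); split; first exact: GD.
  case: D => [[-> ->]|[-> ->]]; case: D' => [[-> ->]|[-> ->]]; [left|right|right|left] => //.
  + by congr pair; apply/funext => i; rewrite /fadd addbCA.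
  + by congr pair; rewrite !faddA.
  + congr pair; apply/funext => i; rewrite /fadd.
      by case: (y i); case: (d i); case: (d' i).
    by case: (x0 i); case: (c i); case: (c' i).
- move=> x1 x2 Y [d [c [H D]]] [d' [c' [H' D']]].
  case: D => [[EY ->]|[EY ->]]; case: D' => [[EY' ->]|[EY' ->]].
  + by apply: Gf H _; rewrite -EY EY'.
  + by case: (mixed _ _ _ _ H H'); rewrite -EY.
  + by case: (mixed _ _ _ _ H' H); rewrite -EY'.
  + have Ed : d = d' by rewrite -(faddK y d) -EY EY' faddK.
    by congr fadd; apply: Gf H _; rewrite Ed.
- move=> Y X w [d [c [H [[-> ->]|[-> ->]]]]] E; first exact: Ga H E.
  exact: Hx0 H E.
Qed.

Lemma section_exists : exists g : fn -> fn,
  (forall u v, g (fadd u v) = fadd (g u) (g v)) /\ forall w, a (g (a w)) = a w.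
Proof.
pose P G := partial_section (with_zero G).
have P0 : P (fun _ => False).
  split=> [y x y' x' [[-> ->]|[]] [[-> ->]|[]]|x x' y [[-> ->]|[]] [[]|[]]|y x w [[-> ->]|[]] _] //.
  - by left; rewrite fadd0.
  - exact: additive0.
have [F FP totF|G [PG Gmax]] := @Zorn_bigcup _ P.
  set U := bigcup _ _.
  have pick2 p q : with_zero U p -> with_zero U q ->
    exists G, [/\ P G, with_zero G p, with_zero G q & forall r, with_zero G r -> with_zero U r].
    have sub X : F X -> forall r, with_zero X r -> with_zero U r.
      by move=> FX r [->|Xr]; [left|right; exists X].
    move=> [Ep|[X FX Xp]] [Eq|[Y FY Yq]].
    - by exists (fun _ => False); split=> //; [left|left|move=> r [->|[]]; left].
    - by exists Y; split; [exact: FP|left|right|exact: sub].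
    - by exists X; split; [exact: FP|right|left|exact: sub].
    - case: (totF _ _ FX FY) => XY; [exists Y|exists X];
        by split; [exact: FP|right => //; exact: XY|right => //; exact: XY|exact: sub].
  split.
  - move=> y x y' x' H H'; have [G [[GD _ _] Gp Gq GU]] := pick2 _ _ H H'.
    exact/GU/GD.
  - by move=> x x' y H H'; have [G [[_ Gf _] Gp Gq GU]] := pick2 _ _ H H'; exact: Gf Gp Gq.
  - by move=> y x w H; have [G [[_ _ Ga] Gp _ _]] := pick2 _ _ H H; exact: Ga Gp.
have total y : exists x, with_zero G (y, x).
  apply: contrapT => noy.
  have [//||x0 Px0] := @section_extend (with_zero G) y _ PG; first by left.
    by move=> x Gx; apply: noy; exists x.
  set G' := (fun p => _) in Px0.
  apply: (Gmax G'); last first.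
    suff E : with_zero G' = G' by rewrite /P E.
    apply/funext => p; apply/propext; split; last by right.
    by case=> // ->; exists fzero, fzero; split; left.
  split; last first.
    move=> sub; apply: noy; exists (fadd x0 fzero); right; apply: sub.
    by exists fzero, fzero; split; [left|right; rewrite (faddC y) fadd0].
  by move=> [d c] H; exists d, c; split; [right|left].
pose g y := projT1 (cid (total y)).
have gP y : with_zero G (y, g y) := projT2 (cid (total y)).
have [GD Gf Ga] := PG.
exists g; split=> [u v|w]; first by apply: Gf (gP _) _; apply: GD.
exact: Ga (gP _) erefl.
Qed.
End Inverse.

(** The inverse found by Zorn's lemma is not local.  It is restricted to functions
    of the first n variables and then applied with the other variables frozen. *)
Lemma lendo_regular : von_neumann_regular local_endo.
Proof.
move=> a; have [n la] := op_local a.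
have [g [gD ga]] := section_exists (@opD a).
pose zero : branch := fun _ => 0%N.
pose b0 (v : fn) : fn := fun x => g (fun y => v (glue n y x)) (glue n x zero).
have b0D u v : b0 (fadd u v) = fadd (b0 u) (b0 v).
  by apply/funext => x; rewrite /b0 -[RHS]/(fadd (g _) (g _) _) -gD.
have b0L : local n b0.
  move=> v x x' E; rewrite /b0.
  have -> : glue n x' zero = glue n x zero.
    by apply/funext => i; rewrite /glue; case: ifP => // lin; rewrite E.
  by congr (g _ _); apply/funext => y; rewrite glue_l.
exists (LocalEndo b0D (ex_intro _ n b0L)); apply: local_endoP => v x.
transitivity (a (b0 (a v)) x); first by [].
rewrite (la (b0 (a v)) x x) //.
pose w : fn := fun y => v (glue n y x).
have wE y z : w (glue n y z) = w y by rewrite /w glue_l.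
have -> : (fun y => b0 (a v) (glue n y x)) = fun y => g (a w) (glue n y zero).
  apply/funext => y; rewrite /b0 glue_l; congr (g _ _).
  by rewrite -(local_glue v _ la); congr (op a _); apply/funext => z; rewrite glue_glue.
rewrite (local_glue (g (a w)) zero la) ga.
transitivity (a (fun y => w (glue n y zero)) x); first by rewrite (local_glue w zero la).
by rewrite [RHS](la v x x) //; congr (op a _ x); apply/funext => y; rewrite wE.
Qed.

(** * Leavitt quadruples *)

Definition leavitt (Q : pzRingType) (s0 s1 t0 t1 : Q) :=
  [/\ t0 * s0 = 1, t1 * s1 = 1, t0 * s1 = 0, t1 * s0 = 0 & s0 * t0 + s1 * t1 = 1].
Definition asymptotically_leavitt (Q : pzRingType) := forall l : seq Q,
  exists s0 s1 t0 t1 : Q, leavitt s0 s1 t0 t1 /\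
  forall a, a \in l -> [/\ s0 * a = a * s0, s1 * a = a * s1, t0 * a = a * t0 & t1 * a = a * t1].

Section Leavitt.
Variable n : nat.
Implicit Types (f : nat -> nat) (x : branch).
Definition modify f x : branch := fun i => if i == n then f (x n) else x i.
Lemma modifyE f g x : modify f (modify g x) = modify (f \o g) x.
Proof. by apply/funext => i; rewrite /modify /= eqxx; case: eqP. Qed.
Lemma modify_id f x : f (x n) = x n -> modify f x = x.
Proof. by move=> E; apply/funext => i; rewrite /modify; case: eqP => // ->. Qed.
Lemma modify_at f x : modify f x n = f (x n).
Proof. by rewrite /modify eqxx. Qed.
Lemma modify_glue f y x : modify f (glue n y x) = glue n y (modify f x).
Proof.
apply/funext => i; rewrite /glue /modify ltnn.
by case: eqP => [->|_]; rewrite ?ltnn.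
Qed.
Lemma modify_glue_next f y x : modify f (glue n.+1 y x) = glue n.+1 (modify f y) x.
Proof.
apply/funext => i; rewrite /glue /modify ltnSn.
by case: eqP => [->|_]; rewrite ?ltnSn.
Qed.
Lemma modify_head f x : same_head n (modify f x) x.
Proof. by move=> i lin; rewrite /modify; case: eqP => // Ei; rewrite Ei ltnn in lin. Qed.

(** Substituting f for the n-th variable, with weight P: such maps act on one
    variable, so they commute with every map that is local in the first n. *)
Definition wcomp f (P : pred nat) (v : fn) : fn := fun x => P (x n) && v (modify f x).
Lemma wcompD f P u v : wcomp f P (fadd u v) = fadd (wcomp f P u) (wcomp f P v).
Proof. by apply/funext => x; rewrite /wcomp /fadd; case: (P _). Qed.
Lemma wcomp_local f P : local n.+1 (wcomp f P).
Proof.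
move=> v x x' E; rewrite /wcomp (E n) // -modify_glue_next; congr (_ && v _).
by rewrite glue_same.
Qed.
Definition lendo_wcomp f P := LocalEndo (wcompD f P) (ex_intro _ n.+1 (wcomp_local f P)).
Lemma lendo_wcomp_comm f P (a : local_endo) : local n a -> lendo_wcomp f P * a = a * lendo_wcomp f P.
Proof.
move=> la; apply: local_endoP => v x.
transitivity (P (x n) && a v (modify f x)); first by [].
transitivity (a (wcomp f P v) x); last by [].
rewrite [RHS](la _ x x) //.
have -> : (fun y => wcomp f P v (glue n y x)) =
    fun y => P (x n) && v (glue n y (modify f x)).
  by apply/funext => y; rewrite /wcomp modify_glue /glue ltnn.
case: (P _) => /=; first exact: la _ _ _ (@modify_head f x).
by rewrite (_ : (fun _ => false) = fzero) // additive0 //; exact: opD.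
Qed.

(** Splitting the natural numbers into evens and odds identifies functions of the
    n-th variable with pairs of such functions. *)
Lemma leavitt_wcomp : leavitt (lendo_wcomp half (fun k => ~~ odd k)) (lendo_wcomp half odd)
  (lendo_wcomp double xpredT) (lendo_wcomp (fun k => k.*2.+1) xpredT).
Proof.
split; apply: local_endoP => v x.
- transitivity (~~ odd (modify double x n) && v (modify half (modify double x))); first by [].
  by rewrite modify_at odd_double modifyE modify_id //= doubleK.
- transitivity (odd (modify (fun k => k.*2.+1) x n) &&
    v (modify half (modify (fun k => k.*2.+1) x))); first by [].
  by rewrite modify_at /= odd_double modifyE modify_id //= uphalf_double.
- transitivity (odd (modify double x n) && v (modify half (modify double x))); first by [].
  by rewrite modify_at odd_double.
- transitivity (~~ odd (modify (fun k => k.*2.+1) x n) &&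
    v (modify half (modify (fun k => k.*2.+1) x))); first by [].
  by rewrite modify_at /= odd_double.
- transitivity ((~~ odd (x n) && v (modify double (modify half x))) (+)
    (odd (x n) && v (modify (fun k => k.*2.+1) (modify half x)))); first by [].
  rewrite !modifyE; have := odd_double_half (x n).
  by case: (odd (x n)) => /= E; rewrite ?addbF modify_id.
Qed.
End Leavitt.

Lemma lendo_asymptotically_leavitt : asymptotically_leavitt local_endo.
Proof.
move=> l.
have [n ln] : exists n, forall a : local_endo, a \in l -> local n a.
  elim: l => [|a l [n ln]]; first by exists 0%N.
  have [m la] := op_local a; exists (maxn m n) => b; rewrite inE => /predU1P[->|/ln].
    exact: local_le (leq_maxl _ _) la.
  exact: local_le (leq_maxr _ _).
do 4!eexists; split; first exact: (leavitt_wcomp n).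
by move=> a /ln la; split; exact: lendo_wcomp_comm.
Qed.

Lemma lendo_nonzero : (1 : local_endo) <> 0.
Proof. by move=> /(congr1 (fun a : local_endo => a (fun _ => true) (fun _ => 0%N))). Qed.

Lemma regular_prod (P Q : pzRingType) : von_neumann_regular P -> von_neumann_regular Q ->
  von_neumann_regular (P * Q)%type.
Proof.
move=> regP regQ [a b]; have [a' Ea] := regP a; have [b' Eb] := regQ b.
by exists (a', b'); rewrite -[LHS]/(a * a' * a, b * b' * b) Ea Eb.
Qed.

Lemma asymptotically_leavitt_prod (P Q : pzRingType) :
  asymptotically_leavitt P -> asymptotically_leavitt Q ->
  asymptotically_leavitt (P * Q)%type.
Proof.
move=> lP lQ l.
have [s0 [s1 [t0 [t1 [[E1 E2 E3 E4 E5] C]]]]] := lP (map fst l).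
have [s0' [s1' [t0' [t1' [[E1' E2' E3' E4' E5'] C']]]]] := lQ (map snd l).
exists (s0, s0'), (s1, s1'), (t0, t0'), (t1, t1'); split.
  split; apply: injective_projections => //=.
move=> [a b] abl.
have [? ? ? ?] := C a (map_f fst abl); have [? ? ? ?] := C' b (map_f snd abl).
by split; apply: injective_projections.
Qed.

(** Present M as the image of an idempotent matrix (the coordinates of the lifted
    generators).  A quadruple that commutes with its entries acts on M and
    identifies M with M + M. *)
Lemma FP_double (Q : pzRingType) (M : rmodType Q) :
  asymptotically_leavitt Q -> FP M -> rmod_iso M (dsum M M).
Proof.
move=> QL [[n [v vgen]] Mproj].
pose F : rmodType Q := 'rV[Q^c]_n.
pose g0 (w : F) : M := \sum_(i < n) w 0 i *: v i.
have g0L : linear g0.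
  move=> c x y; rewrite /g0 scaler_sumr -big_split /=; apply: eq_bigr => i _.
  by rewrite !mxE scalerDl scalerA.
pose g : {linear F -> M} := HB.pack g0 (GRing.isLinear.Build _ _ _ _ _ g0L).
have gE w : g w = \sum_(i < n) w 0 i *: v i by [].
have gS x : exists w, g w = x.
  have [c ->] := vgen x; exists (\row_i c i).
  by rewrite gE; apply: eq_bigr => i _; rewrite mxE.
have [h gh] := Mproj _ _ g (lid M) gS.
have [s0 [s1 [t0 [t1 [[E1 E2 E3 E4 E5] C]]]]] :=
  QL [seq (h (v i) 0 j : Q) | i <- enum 'I_n, j <- enum 'I_n].
have inl i j : (h (v i) 0 j : Q) \in [seq (h (v i) 0 j : Q) | i <- enum 'I_n, j <- enum 'I_n].
  by apply: allpairs_f; rewrite mem_enum.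
pose m0 (t : Q) (w : F) : F := \row_j (t * w 0 j : Q).
have m0L t : linear (m0 t).
  move=> c x y; apply/rowP => j; rewrite !mxE.
  by rewrite [LHS]mulrDr mulrA.
pose m t : {linear F -> F} := HB.pack (m0 t) (GRing.isLinear.Build _ _ _ _ _ (m0L t)).
have mE t w j : m t w 0 j = (t * w 0 j : Q) by rewrite /= mxE.
have mM s t w : m s (m t w) = m (s * t) w.
  by apply/rowP => j; rewrite !mE mulrA.
have mD s t w : m s w + m t w = m (s + t) w.
  by apply/rowP => j; rewrite !mE mxE !mE mulrDl.
have m1 w : m 1 w = w by apply/rowP => j; rewrite mE mul1r.
have mz w : m 0 w = 0 by apply/rowP => j; rewrite mE mul0r mxE.
have comm t w : (forall i j, t * (h (v i) 0 j : Q) = (h (v i) 0 j : Q) * t) ->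
    m t (h (g w)) = h (g (m t w)).
  move=> ct; apply/rowP => j; rewrite mE.
  have hg w' : h (g w') 0 j = \sum_(i < n) ((h (v i) 0 j : Q) * (w' 0 i : Q)).
    by rewrite gE linear_sum summxE; apply: eq_bigr => i _; rewrite linearZ mxE.
  rewrite !hg mulr_sumr; apply: eq_bigr => i _.
  by rewrite mE mulrA ct -mulrA.
have comm_g t w : (forall i j, t * (h (v i) 0 j : Q) = (h (v i) 0 j : Q) * t) ->
    g (m t (h (g w))) = g (m t w) by move=> ct; rewrite comm // gh.
pose D (t : Q) : {linear M -> M} := lcomp g (lcomp (m t) h).
have DM s t x : (forall i j, s * (h (v i) 0 j : Q) = (h (v i) 0 j : Q) * s) ->
    D s (D t x) = g (m (s * t) (h x)).
  by move=> cs; rewrite -mM -(comm_g s (m t (h x)) cs).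
have [cs0 [cs1 [ct0 ct1]]] : [/\ forall i j, s0 * (h (v i) 0 j : Q) = (h (v i) 0 j : Q) * s0 &
   (forall i j, s1 * (h (v i) 0 j : Q) = (h (v i) 0 j : Q) * s1) /\ 
   (forall i j, t0 * (h (v i) 0 j : Q) = (h (v i) 0 j : Q) * t0) /\
   (forall i j, t1 * (h (v i) 0 j : Q) = (h (v i) 0 j : Q) * t1)].
  by split; [|split; [|split]]; move=> i j; have [] := C _ (inl i j).
have e1 x : g (m 1 (h x)) = x by rewrite m1 gh.
have e0 x : g (m 0 (h x)) = 0 by rewrite mz linear0.
apply: (@rmod_iso_intro _ _ _ (lpair (D t0) (D t1))
   (ladd (lcomp (D s0) (lfst M M)) (lcomp (D s1) (lsnd M M)))) => [x|[x y]].
  transitivity (D s0 (D t0 x) + D s1 (D t1 x)); first by [].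
  rewrite !DM //; apply: etrans (esym (linearD g _ _)) _.
  by rewrite mD E5 e1.
transitivity (D t0 (D s0 x + D s1 y), D t1 (D s0 x + D s1 y)); first by [].
rewrite !linearD !DM //.
by rewrite E1 E2 E3 E4 !e1 !e0 addr0 add0r.
Qed.

(** With C = C + C, the hypothesis on A + C + C and B + C + C is already the
    conclusion on A + C and B + C. *)
Lemma asymptotically_leavitt_separative (Q : pzRingType) :
  asymptotically_leavitt Q -> separative Q.
Proof.
move=> QL A B C _ _ FC iso.
have double (M : rmodType Q) : rmod_iso (dsum M C) (dsum (dsum M C) C).
  apply: rmod_iso_trans (dsumA _ _ _).
  by apply: dsum_iso; [exact: rmod_iso_refl|exact: FP_double].
exact: rmod_iso_trans (double A) (rmod_iso_trans iso (rmod_iso_sym (double B))).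
Qed.

(** * Matrices that resist two operations on one side *)

Section Products.
Variable Q : pzRingType.
Implicit Types A B : 'M[Q]_2.

Lemma mulmx2E A B i j : (A *m B) i j = A i 0 * B 0 j + A i 1 * B 1 j.
Proof.
rewrite mxE !big_ord_recl big_ord0 addr0; congr (_ + A i _ * B _ j); exact: val_inj.
Qed.
Lemma mx_prod_nil : mx_prod (R := Q) [::] = 1%:M.
Proof. by rewrite /mx_prod big_nil. Qed.
Lemma mx_prod_cons A s : mx_prod (A :: s) = A *m mx_prod s.
Proof. by rewrite /mx_prod big_cons. Qed.

Lemma elementary_inv A : elementary A -> exists B, A *m B = 1%:M /\ B *m A = 1%:M.
Proof.
have E1 : 1%:M = mx2 1 0 0 1 :> 'M[Q]_2 by rewrite [LHS]mx2_eta !mxE.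
case=> x [->|->].
  by exists (upper (- x)); rewrite -/(upper x) !upperD subrr addNr /upper E1.
by exists (lower (- x)); rewrite -/(lower x) !lowerD subrr addNr /lower E1.
Qed.

Lemma mx_prod_inv (s : seq 'M[Q]_2) : elementary_seq s ->
  exists B, mx_prod s *m B = 1%:M /\ B *m mx_prod s = 1%:M.
Proof.
elim: s => [_|A s IH As]; first by exists 1%:M; rewrite mx_prod_nil mulmx1.
have [B [AB BA]] := elementary_inv (As _ (mem_head _ _)).
have [|C [sC Cs]] := IH; first by move=> E Es; apply: As; rewrite inE Es orbT.
exists (C *m B); rewrite mx_prod_cons; split.
  by rewrite mulmxA -(mulmxA A) sC mulmx1.
by rewrite mulmxA -(mulmxA C) BA mulmx1.
Qed.

(** Of two consecutive elementary matrices of different kinds, the product has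
    diagonal entry 1 in the row where the left factor agrees with 1. *)
Lemma mx_prod2_diag (s : seq 'M[Q]_2) : elementary_seq s -> (size s <= 2)%N ->
  mx_prod s 0 0 = 1 \/ mx_prod s 1 1 = 1.
Proof.
case: s => [|A [|B [|//]]] es _.
- by left; rewrite mx_prod_nil mxE.
- rewrite mx_prod_cons mx_prod_nil mulmx1; left.
  by have [x [->|->]] := es _ (mem_head _ _); rewrite mxE.
- rewrite !mx_prod_cons mx_prod_nil mulmx1 !mulmx2E.
  have [x [->|->]] := es _ (mem_head _ _);
    (have [|y [->|->]] := es B; first by rewrite !inE eqxx orbT);
    rewrite !mxE /= !(mul1r, mulr1, mul0r, mulr0, addr0, add0r); by [left|right].
Qed.
End Products.

Section Obstruction.
Variable Q : pzRingType.
Variables s0 s1 t0 t1 : Q.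
Hypothesis st : leavitt s0 s1 t0 t1.
Hypothesis Q1 : (1 : Q) <> 0.
Local Notation S := (Q * Q)%type.

Lemma leavitt_row_injective x y : s0 * x + s1 * y = 0 -> x = 0 /\ y = 0.
Proof.
have [E1 E2 E3 E4 _] := st => E; split.
  by have := congr1 (fun w => t0 * w) E; rewrite mulrDr !mulrA E1 E3 mul1r mul0r mulr0 addr0.
by have := congr1 (fun w => t1 * w) E; rewrite mulrDr !mulrA E4 E2 mul1r mul0r mulr0 add0r.
Qed.
Lemma leavitt_column_injective x y : x * t0 + y * t1 = 0 -> x = 0 /\ y = 0.
Proof.
have [E1 E2 E3 E4 _] := st => E; split.
  by have := congr1 (fun w => w * s0) E; rewrite mulrDl -!mulrA E1 E4 mulr1 mulr0 mul0r addr0.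
by have := congr1 (fun w => w * s1) E; rewrite mulrDl -!mulrA E3 E2 mulr1 mulr0 mul0r add0r.
Qed.

(** The first factor sees the row (s0, s1) on top of zero, the second factor sees
    it below zero; the columns are placed likewise in the other matrix. *)
Definition row_obstruction : 'M[S]_2 := mx2 (s0, 0) (s1, 0) (0, s0) (0, s1).
Definition column_obstruction : 'M[S]_2 := mx2 (t0, 0) (0, t0) (t1, 0) (0, t1).

(** When the diagonal entry 1 of the row operations is in the top row, the first
    factor keeps its row (s0, s1), and a zero in that row forces a zero column in
    the invertible matrix of column operations; symmetrically for the other
    diagonal entry and the second factor. *)
Lemma row_obstructionP Es Fs : elementary_seq Es -> elementary_seq Fs -> (size Es <= 2)%N ->
  ~ is_diag_mx (mx_prod Es *m row_obstruction *m mx_prod Fs).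
Proof.
move=> eE eF sE /is_diag_mxP diag.
have [G [_ GF]] := mx_prod_inv eF.
case: (mx_prod2_diag eE sE) => P1.
- have := congr1 fst (diag 0 1 isT); rewrite !mulmx2E P1 !mxE /=.
  rewrite !mulr0 !addr0 !mul1r => /leavitt_row_injective[F0 F1].
  have := congr1 (fun M : 'M[S]_2 => (M 1 1).1) GF.
  by rewrite mulmx2E !mxE /= F0 F1 !mulr0 addr0 => /esym.
- have := congr1 snd (diag 1 0 isT); rewrite !mulmx2E P1 !mxE /=.
  rewrite !mulr0 !add0r !mul1r => /leavitt_row_injective[F0 F1].
  have := congr1 (fun M : 'M[S]_2 => (M 0 0).2) GF.
  by rewrite mulmx2E !mxE /= F0 F1 !mulr0 addr0 => /esym.
Qed.

Lemma column_obstructionP Es Fs : elementary_seq Es -> elementary_seq Fs -> (size Fs <= 2)%N ->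
  ~ is_diag_mx (mx_prod Es *m column_obstruction *m mx_prod Fs).
Proof.
move=> eE eF sF; rewrite -mulmxA => /is_diag_mxP diag.
have [G [EG _]] := mx_prod_inv eE.
case: (mx_prod2_diag eF sF) => P1.
- have := congr1 fst (diag 1 0 isT); rewrite !mulmx2E P1 !mxE /=.
  rewrite !mul0r !addr0 !mulr1 => /leavitt_column_injective[F0 F1].
  have := congr1 (fun M : 'M[S]_2 => (M 1 1).1) EG.
  by rewrite mulmx2E !mxE /= F0 F1 !mul0r addr0 => /esym.
- have := congr1 snd (diag 0 1 isT); rewrite !mulmx2E P1 !mxE /=.
  rewrite !mul0r !add0r !mulr1 => /leavitt_column_injective[F0 F1].
  have := congr1 (fun M : 'M[S]_2 => (M 0 0).2) EG.
  by rewrite mulmx2E !mxE /= F0 F1 !mul0r addr0 => /esym.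
Qed.
End Obstruction.

Theorem theorem7p5 :
  (* (1) *)
  ((forall R : pzRingType,
      von_neumann_regular R -> core_separative R ->
      forall A : 'M[R]_2,
      exists E1 E2 E3 F1 F2 F3 : 'M[R]_2,
        (elementary E1 /\ elementary E2 /\ elementary E3) /\
        (elementary F1 /\ elementary F2 /\ elementary F3) /\
        is_diag_mx (E3 *m E2 *m E1 *m A *m F1 *m F2 *m F3)) /\
   (forall R : pzRingType,
      von_neumann_regular R -> separative R -> core_separative R)) /\
  (* (2) *)
  ((exists S : pzRingType,
      von_neumann_regular S /\ separative S /\
      exists A : 'M[S]_2,
      forall Es Fs : seq 'M[S]_2,
        elementary_seq Es -> elementary_seq Fs -> (size Es <= 2)%N ->
        ~ is_diag_mx (mx_prod Es *m A *m mx_prod Fs)) /\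
   (exists T : pzRingType,
      von_neumann_regular T /\ separative T /\
      exists A : 'M[T]_2,
      forall Es Fs : seq 'M[T]_2,
        elementary_seq Es -> elementary_seq Fs -> (size Fs <= 2)%N ->
        ~ is_diag_mx (mx_prod Es *m A *m mx_prod Fs))).
Proof.
split; first split.
- by move=> R Rreg Rcore A; exact: three_three_reduction.
- by move=> R _ Rsep A B C FA FB FC _; exact: Rsep.
(* One ring serves both negative statements. *)
have regS := regular_prod lendo_regular lendo_regular.
have sepS := asymptotically_leavitt_separative
  (asymptotically_leavitt_prod lendo_asymptotically_leavitt lendo_asymptotically_leavitt).
have st := leavitt_wcomp 0.
split; exists (local_endo * local_endo)%type; (split; [exact: regS|split; first exact: sepS]).
- by eexists; exact: (row_obstructionP st lendo_nonzero).
- by eexists; exact: (column_obstructionP st lendo_nonzero).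
Qed.
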